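(* Let $(M,\omega)$ be a compact Hermitian manifold of complex dimension $n\ge 3$. Suppose that $\omega$ is pluriclosed and balanced, and satisfies $$\Theta^{(3)}(\omega)+\Theta^{(4)}(\omega)=f\omega$$ for some $f\in C^\infty(M,\mathbb{R})$. Then exactly one of the following holds: (1) $S_C^{(2)}(\omega)\equiv 0$; or (2) $\omega$ is Kähler--Einstein with non-zero scalar curvature.
   Context: All manifolds are connected. A Hermitian metric is identified with its fundamental form $\omega=\sqrt{-1}\,h_{i\bar j}\,dz^i\wedge d\bar z^j$; $(h^{i\bar j})$ is the inverse matrix of $(h_{i\bar j})$. $\omega$ is balanced if $d\omega^{n-1}=0$ and pluriclosed if $\partial\bar\partial\omega=0$. The Chern curvature of $\omega$ is $$\Theta_{i\bar jk\bar l}(\omega)=-\frac{\partial^2h_{k\bar l}}{\partial z^i\partial\bar z^j}+h^{p\bar q}\frac{\partial h_{p\bar l}}{\partial\bar z^j}\frac{\partial h_{k\bar q}}{\partial z^i}.$$ The third and fourth Chern--Ricci curvatures are $\Theta^{(3)}(\omega)=\sqrt{-1}\,\Theta^{(3)}_{i\bar j}dz^i\wedge d\bar z^j$ with $\Theta^{(3)}_{i\bar j}=h^{k\bar l}\Theta_{i\bar lk\bar j}$, and $\Theta^{(4)}(\omega)=\sqrt{-1}\,\Theta^{(4)}_{i\bar j}dz^i\wedge d\bar z^j$ with $\Theta^{(4)}_{i\bar j}=h^{k\bar l}\Theta_{k\bar ji\bar l}$. The second Chern scalar curvature is $S_C^{(2)}(\omega)=h^{i\bar l}h^{k\bar j}\Theta_{i\bar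 jk\bar l}(\omega)$. *)

(* Defs.v *)
From HB Require Import structures.
From mathcomp Require Import all_boot all_order all_algebra.
From mathcomp Require Import all_classical all_reals all_analysis.
From mathcomp Require Import complex.

Set Implicit Arguments.
Unset Strict Implicit.
Unset Printing Implicit Defensive.

Import Order.TTheory GRing.Theory Num.Theory.
Import numFieldNormedType.Exports.

Local Open Scope classical_set_scope.
Local Open Scope ring_scope.
Local Open Scope complex_scope.

(* The usual topology and norm of the complex field; numFieldNormedType does
   not provide them on the concrete type R[i]. *)
HB.instance Definition _ (R : realType) := NormedModule.copy R[i] R[i]^o.

Section Calculus.
Context {R : realType} {n : nat}.
Local Notation C := R[i].
Local Notation Cn := 'rV[C]_n.

(* [(false, j)] stands for the real direction x^j and [(true, j)] for y^j,
   where z^j = x^j + i y^j. *)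
Definition real_dir (d : bool * 'I_n) : Cn :=
  (if d.1 then 'i%C else 1) *: delta_mx 0 d.2.

Definition re_along (d : bool * 'I_n) (f : Cn -> C) (z : Cn) (t : R) : R :=
  complex.Re (f (z + t%:C *: real_dir d)).

Definition im_along (d : bool * 'I_n) (f : Cn -> C) (z : Cn) (t : R) : R :=
  complex.Im (f (z + t%:C *: real_dir d)).

Definition partial_ex (d : bool * 'I_n) (f : Cn -> C) (z : Cn) : Prop :=
  derivable (re_along d f z) 0 1 /\ derivable (im_along d f z) 0 1.

Definition partial (d : bool * 'I_n) (f : Cn -> C) (z : Cn) : C :=
  derive1 (re_along d f z) 0 +i* derive1 (im_along d f z) 0.

(* C^oo in the real sense on an open set [U]: the partial derivatives of all
   orders with respect to x^1, y^1, ..., x^n, y^n exist and are continuous. *)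
Definition smooth_on (U : set Cn) (f : Cn -> C) : Prop :=
  forall (w : seq (bool * 'I_n)) (z : Cn), U z ->
    {for z, continuous (foldr partial f w)} /\
    forall d, partial_ex d (foldr partial f w) z.

Definition dz (j : 'I_n) (f : Cn -> C) (z : Cn) : C :=
  2%:R^-1 * (partial (false, j) f z - 'i%C * partial (true, j) f z).

Definition dzbar (j : 'I_n) (f : Cn -> C) (z : Cn) : C :=
  2%:R^-1 * (partial (false, j) f z + 'i%C * partial (true, j) f z).

(* Complex differential forms of mixed degree in the coordinates z^1 .. z^n.
   The coframe is indexed by 'I_(n + n): [lshift n j] stands for dz^j and
   [rshift n j] for its conjugate. [a z S] is the coefficient of [a] at [z] on
   the wedge product, in increasing order, of the covectors in [S]. *)
Definition form := Cn -> {set 'I_(n + n)} -> C.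

(* The sign of sorting the concatenation of [A] and [B]. *)
Definition shuffle_sign (A B : {set 'I_(n + n)}) : C :=
  (-1) ^+ #|[set ab in finset.setX A B | (ab.2 < ab.1)%N]%SET|.

Definition wedge (a b : form) : form := fun z S =>
  \sum_(A in powerset S)
     shuffle_sign A (S :\: A)%SET * a z A * b z (S :\: A)%SET.

Definition form1 : form := fun _ S => (S == finset.set0)%:R.

Definition wedge_pow (a : form) (k : nat) : form := iter k (wedge a) form1.

Definition del (a : form) : form := fun z S =>
  \sum_(j < n | lshift n j \in S)
     shuffle_sign [set lshift n j]%SET (S :\ lshift n j)%SET *
     dz j (fun w => a w (S :\ lshift n j)%SET) z.

Definition delbar (a : form) : form := fun z S =>
  \sum_(j < n | rshift n j \in S)
     shuffle_sign [set rshift n j]%SET (S :\ rshift n j)%SET *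
     dzbar j (fun w => a w (S :\ rshift n j)%SET) z.

Definition extd (a : form) : form := fun z S => del a z S + delbar a z S.

Definition form_zero_on (U : set Cn) (a : form) : Prop :=
  forall z, U z -> forall S, a z S = 0.

Section LocalMetric.
Variable h : Cn -> 'M[C]_n.

Definition fundamental_form : form := fun z S =>
  \sum_(i < n) \sum_(j < n)
     'i%C * h z i j * (S == [set lshift n i; rshift n j]%SET)%:R.

(* h^{p qbar}, normalised by \sum_q h^{p qbar} h_{k qbar} = delta_{pk}; hence
   the transpose of the inverse matrix of (h_{k qbar}). *)
Definition hinv (z : Cn) (p q : 'I_n) : C := invmx (h z) q p.

(* [chern z i j k l] is Theta_{i jbar k lbar}. *)
Definition chern (z : Cn) (i j k l : 'I_n) : C :=
  - dz i (dzbar j (fun w => h w k l)) z +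
  \sum_(p < n) \sum_(q < n)
     hinv z p q * dzbar j (fun w => h w p l) z * dz i (fun w => h w k q) z.

Definition chern_ricci1 (z : Cn) : 'M[C]_n :=
  \matrix_(i < n, j < n) \sum_(k < n) \sum_(l < n) hinv z k l * chern z i j k l.

Definition chern_ricci3 (z : Cn) : 'M[C]_n :=
  \matrix_(i < n, j < n) \sum_(k < n) \sum_(l < n) hinv z k l * chern z i l k j.

Definition chern_ricci4 (z : Cn) : 'M[C]_n :=
  \matrix_(i < n, j < n) \sum_(k < n) \sum_(l < n) hinv z k l * chern z k j i l.

Definition chern_scalar1 (z : Cn) : C :=
  \sum_(i < n) \sum_(j < n) hinv z i j * chern_ricci1 z i j.

Definition chern_scalar2 (z : Cn) : C :=
  \sum_(i < n) \sum_(j < n) \sum_(k < n) \sum_(l < n)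
     hinv z i l * hinv z k j * chern z i j k l.

End LocalMetric.

Definition adjoint_mx (A : 'M[C]_n) : 'M[C]_n := (map_mx (@conjc R) A)^T.

Definition hermitian_posdef (A : 'M[C]_n) : Prop :=
  adjoint_mx A = A /\
  forall v : Cn, v != 0 -> 0 < (v *m A *m (map_mx (@conjc R) v)^T) 0 0.

End Calculus.

Section Manifold.
Context {R : realType} {n : nat} {T : topologicalType}.
Local Notation C := R[i].
Local Notation Cn := 'rV[C]_n.

Record chart := Chart {
  chart_dom : set T;
  chart_map : T -> Cn;
  chart_inv : Cn -> T;
  chart_dom_open : open chart_dom;
  chart_img_open : open (chart_map @` chart_dom);
  chart_mapK : {in chart_dom, cancel chart_map chart_inv};
  chart_map_continuous : {within chart_dom, continuous chart_map};
  chart_inv_continuous : {within chart_map @` chart_dom, continuous chart_inv}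
}.

Definition chart_img (c : chart) : set Cn := chart_map c @` chart_dom c.

Definition transition (c c' : chart) : Cn -> Cn := chart_map c' \o chart_inv c.

Definition overlap (c c' : chart) : set Cn :=
  chart_map c @` (chart_dom c `&` chart_dom c').

(* Differentiability over the field R[i], i.e. holomorphy. *)
Record complex_manifold := ComplexManifold {
  atlas : set chart;
  atlas_cover : forall p : T, exists2 c, atlas c & chart_dom c p;
  atlas_holomorphic : forall c c', atlas c -> atlas c' ->
    forall z, overlap c c' z -> differentiable (transition c c') z;
  manifold_hausdorff : hausdorff_space T;
  manifold_second_countable : @second_countable T;
  manifold_nonempty : [set: T] !=set0;
  manifold_connected : connected [set: T]
}.

Variable M : complex_manifold.

(* [metric_coef g c z i j] is h_{i jbar} at the point of coordinates [z] in the
   chart [c]. The (i, k) entry of the Jacobian matrix is the derivative of the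
   k-th component of the transition map with respect to z^i. *)
Record hermitian_metric := HermitianMetric {
  metric_coef : chart -> Cn -> 'M[C]_n;
  metric_smooth : forall c, atlas M c -> forall i j,
    smooth_on (chart_img c) (fun z => metric_coef c z i j);
  metric_posdef : forall c, atlas M c -> forall z, chart_img c z ->
    hermitian_posdef (metric_coef c z);
  metric_transition : forall c c', atlas M c -> atlas M c' ->
    forall z, overlap c c' z ->
    let J := 'J (transition c c') z in
    metric_coef c z =
      J *m metric_coef c' (transition c c' z) *m adjoint_mx J
}.

Definition smooth_real_function (f : T -> R) : Prop :=
  forall c, atlas M c -> smooth_on (chart_img c) (fun z => (f (chart_inv c z))%:C).

Variable g : hermitian_metric.

Definition pluriclosed : Prop :=
  forall c, atlas M c ->
    form_zero_on (chart_img c) (del (delbar (fundamental_form (metric_coef g c)))).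

Definition balanced : Prop :=
  forall c, atlas M c ->
    form_zero_on (chart_img c)
      (extd (wedge_pow (fundamental_form (metric_coef g c)) n.-1)).

Definition kaehler : Prop :=
  forall c, atlas M c ->
    form_zero_on (chart_img c) (extd (fundamental_form (metric_coef g c))).

(* sqrt(-1) A_{i jbar} dz^i dzbar^j is identified with its coefficient matrix. *)
Definition chern_ricci34_eq (f : T -> R) : Prop :=
  forall c, atlas M c -> forall z, chart_img c z ->
    chern_ricci3 (metric_coef g c) z + chern_ricci4 (metric_coef g c) z =
    (f (chart_inv c z))%:C *: metric_coef g c z.

Definition chern_scalar2_zero : Prop :=
  forall c, atlas M c -> forall z, chart_img c z ->
    chern_scalar2 (metric_coef g c) z = 0.

(* The Chern connection of a Kaehler metric is the Levi-Civita connection, so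
   [chern_ricci1] is its Ricci tensor and [chern_scalar1] its scalar curvature
   (half the Riemannian one, depending on conventions). *)
Definition kaehler_einstein : Prop :=
  kaehler /\
  exists lambda : R, forall c, atlas M c -> forall z, chart_img c z ->
    chern_ricci1 (metric_coef g c) z = lambda%:C *: metric_coef g c z.

Definition scalar_curvature_neq0 : Prop :=
  forall c, atlas M c -> forall z, chart_img c z ->
    chern_scalar1 (metric_coef g c) z != 0.

End Manifold.

Arguments chart : clear implicits.
Arguments complex_manifold : clear implicits.

(* Main.v *)
Require Import Defs.
From mathcomp Require Import all_boot all_order all_algebra.
From mathcomp Require Import all_classical all_reals all_analysis.
From mathcomp Require Import complex.
From HB Require Import structures.
From mathcomp Require Import ring lra zify.

(** Let [tau_i = h^{k lbar} (d_i h_{k lbar} - d_k h_{i lbar})] be the trace of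
    the Chern torsion.  By Lefschetz theory, the [(n, n - 1)] part of
    [d omega^{n-1} = (n - 1) omega^{n-2} /\ d omega] determines [tau], so that a
    balanced metric has [tau = 0].  Differentiating [tau] along [dbar_j] gives
    [Theta^(4) = Theta^(1)], and [Theta^(3) = Theta^(1)] follows by conjugation.
    The hypothesis thus becomes [2 Theta^(1) = f omega].  Since
    [Theta^(1) = - d dbar log det h] is closed, [d (f omega) = 0]; contracting
    with [h^{i jbar}] and using [tau = 0] leaves [(n - 1) df = 0], so [f] is
    constant.  If [f = 0] then [S_C^(2) = tr Theta^(3)] vanishes; otherwise
    [d omega = 0] and the Ricci form is [(f / 2) omega].  The two cases are
    exclusive because [S_C^(2) = tr Theta^(3) = tr Theta^(1)]. *)

Set Implicit Arguments.
Unset Strict Implicit.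
Unset Printing Implicit Defensive.

Import Order.TTheory GRing.Theory Num.Theory.
Import numFieldNormedType.Exports.

(** * Partial derivatives *)

(** The obstacle is to extract [tau] from [d omega^{n-1} = 0] without a unitary frame and without
    the coefficients of the power. At a point, the covectors [eta_i = sqrt(-1) sum_j h_{i jbar}
    dzbar^j] give [omega = sum_i dz^i /\ eta_i]. Multiplications by the [dz^i] and [eta_i] and the
    dual contractions satisfy canonical anticommutation relations, and the Lefschetz sl_2-relations
    follow from these alone; they are proved over an abstract vector space and then specialised to
    functions of subsets of the coframe. The contraction of [d omega] is a 1-form whose [dz^m]
    coefficient is [tau_m]. The function [log det h] is never formed: its derivative
    [h^{k lbar} d_i h_{k lbar}] suffices, and closedness of [Theta^(1)] becomes a symmetry of second
    derivatives. Since partial derivatives are real one-variable limits, Clairaut's theorem is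
    proved for them. All computations are local; [f] being a global function, connectedness yields
    one Einstein constant for all charts. *)

Section Partial.
Local Open Scope classical_set_scope.
Local Open Scope ring_scope.
Local Open Scope complex_scope.
Context {R : realType} {n : nat}.
Local Notation C := R[i].
Local Notation Cn := 'rV[C]_n.
Implicit Types (d : bool * 'I_n) (f g : Cn -> C) (z : Cn) (l m : C).

(** Existence and value together: [partial] is total, and its value carries no information where the
    derivative does not exist. *)
Definition is_partial d f z l : Prop :=
  is_derive (0 : R) 1 (re_along d f z) (complex.Re l) /\
  is_derive (0 : R) 1 (im_along d f z) (complex.Im l).

Lemma is_partial_ex d f z l : is_partial d f z l -> partial_ex d f z.
Proof. by case=> [[? _] [? _]]. Qed.

Lemma is_partial_val d f z l : is_partial d f z l -> partial d f z = l.
Proof.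
by case=> [[_ r] [_ i]]; rewrite /partial !derive1E r i; case: l {r i}.
Qed.

Lemma partial_exP d f z : partial_ex d f z -> is_partial d f z (partial d f z).
Proof. by case=> r i; split; rewrite /= derive1E; exact: derivableP. Qed.

Lemma is_partial_cst d c z : is_partial d (fun=> c) z 0.
Proof. by split; exact: is_derive_cst. Qed.

Lemma ReD (x y : C) : complex.Re (x + y) = complex.Re x + complex.Re y.
Proof. by case: x; case: y. Qed.
Lemma ImD (x y : C) : complex.Im (x + y) = complex.Im x + complex.Im y.
Proof. by case: x; case: y. Qed.
Lemma ReN (x : C) : complex.Re (- x) = - complex.Re x. Proof. by case: x. Qed.
Lemma ImN (x : C) : complex.Im (- x) = - complex.Im x. Proof. by case: x. Qed.
Lemma ReM (x y : C) : complex.Re (x * y) =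
  complex.Re x * complex.Re y - complex.Im x * complex.Im y.
Proof. by case: x; case: y. Qed.
Lemma ImM (x y : C) : complex.Im (x * y) =
  complex.Re x * complex.Im y + complex.Im x * complex.Re y.
Proof. by case: x => a b; case: y => c d. Qed.

Lemma is_partialD d f g z l m : is_partial d f z l -> is_partial d g z m ->
  is_partial d (fun w => f w + g w) z (l + m).
Proof.
move=> [fr fi] [gr gi]; split.
- rewrite ReD (_ : re_along _ _ _ = re_along d f z \+ re_along d g z).
    exact: is_deriveD.
  by apply/funext => t; rewrite /re_along /= ReD.
- rewrite ImD (_ : im_along _ _ _ = im_along d f z \+ im_along d g z).
    exact: is_deriveD.
  by apply/funext => t; rewrite /im_along /= ImD.
Qed.

Lemma is_partialM d f g z l m : is_partial d f z l -> is_partial d g z m ->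
  is_partial d (fun w => f w * g w) z (l * g z + f z * m).
Proof.
move=> [fr fi] [gr gi].
have z0 : z + (0%:C : C) *: real_dir d = z by rewrite scale0r addr0.
split.
- rewrite (_ : re_along _ _ _ = (re_along d f z * re_along d g z) -
     (im_along d f z * im_along d g z)); last first.
    by apply/funext => t; rewrite /re_along /= ReM.
  apply: is_derive_eq.
  rewrite /re_along /im_along z0 ReD !ReM /GRing.scale /=; ring.
- rewrite (_ : im_along _ _ _ = (re_along d f z * im_along d g z) +
     (im_along d f z * re_along d g z)); last first.
    by apply/funext => t; rewrite /im_along /= ImM.
  apply: is_derive_eq.
  rewrite /re_along /im_along z0 ImD !ImM /GRing.scale /=; ring.
Qed.

Lemma ReJ (x : C) : complex.Re (conjc x) = complex.Re x. Proof. by case: x. Qed.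
Lemma ImJ (x : C) : complex.Im (conjc x) = - complex.Im x. Proof. by case: x. Qed.

Lemma is_partial_conj d f z l : is_partial d f z l ->
  is_partial d (fun w => conjc (f w)) z (conjc l).
Proof.
move=> [fr fi]; split.
- rewrite ReJ (_ : re_along _ _ _ = re_along d f z)//.
  by apply/funext => t; rewrite /re_along ReJ.
- rewrite ImJ (_ : im_along _ _ _ = - im_along d f z).
    exact: is_deriveN.
  by apply/funext => t; rewrite /im_along ImJ.
Qed.

Lemma normc_real (t : R) : `|t%:C : C| = `|t|%:C.
Proof. by rewrite normc_def /= expr0n addr0 sqrtr_sqr. Qed.

Lemma gt0_complexE (e : C) : 0 < e -> 0 < complex.Re e /\ e = (complex.Re e)%:C.
Proof.
by case: e => a b; rewrite ltcE /= => /andP[/eqP-> ?].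
Qed.

Lemma continuous_real_complex : continuous (fun t : R => t%:C : C).
Proof.
move=> t; apply/cvgrPdist_lt => e /gt0_complexE[e0 eE].
near=> s; rewrite -rmorphB normc_real eE ltcR.
near: s; exact: cvgr_dist_lt.
Unshelve. all: by end_near. Qed.

Lemma continuous_Re : continuous (@complex.Re R : C -> R).
Proof.
move=> x. 
apply/(@cvgrPdist_lt _ _ _ (nbhs (x : C^o)) _)=> e e0.
apply/nbhs_ballP; exists e%:C.
  by rewrite /= ltcR.
move=> y; rewrite -ball_normE /= -ltcR.
move=> xy; apply: le_lt_trans xy.
by rewrite -ReN -ReD normc_ge_Re.
Qed.

Lemma normc_ge_Im (x : C) : `|complex.Im x|%:C <= `|x|.
Proof.
have -> : complex.Im x = complex.Re (- 'i%C * x).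
  by case: x => a b /=; rewrite oppr0 mul0r sub0r mulN1r opprK.
rewrite (le_trans (normc_ge_Re _))// normrM normrN.
by rewrite (normc_def 'i%C) /= expr0n expr1n add0r sqrtr1 mul1r.
Qed.

Lemma continuous_Im : continuous (@complex.Im R : C -> R).
Proof.
move=> x; apply/(@cvgrPdist_lt _ _ _ (nbhs (x : C^o)) _) => e e0.
apply/nbhs_ballP; exists e%:C; first by rewrite /= ltcR.
move=> y; rewrite -ball_normE /= -ltcR => xy; apply: le_lt_trans xy.
by rewrite -ImN -ImD normc_ge_Im.
Qed.

Lemma cvg_real_line z (v : Cn) : (fun t : R => z + (t%:C : C) *: v) @ (0 : R) --> z.
Proof.
have z0 : z + (0%:C : C) *: v = z by rewrite scale0r addr0.
rewrite -[X in _ --> X]z0; apply: cvgD; first exact: cvg_cst.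
apply: cvgZr_tmp.
exact: continuous_real_complex.
Qed.

Lemma is_partial_near d f g z l : (\near z, f z = g z) ->
  is_partial d f z l -> is_partial d g z l.
Proof.
move=> fg; have fgt : \forall t \near (0 : R),
    f (z + t%:C *: real_dir d) = g (z + t%:C *: real_dir d).
  exact: (@cvg_real_line z (real_dir d) _ fg).
case=> fr fi; split.
- by apply: near_eq_is_derive fr => //; apply: filterS fgt => t; rewrite /re_along => ->.
- by apply: near_eq_is_derive fi => //; apply: filterS fgt => t; rewrite /im_along => ->.
Qed.

Lemma Re_inv (x : C) : complex.Re x^-1 =
  complex.Re x / (complex.Re x ^+ 2 + complex.Im x ^+ 2).
Proof. by case: x. Qed.
Lemma Im_inv (x : C) : complex.Im x^-1 =
  - (complex.Im x / (complex.Re x ^+ 2 + complex.Im x ^+ 2)).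
Proof. by case: x => a b. Qed.

Lemma is_partialV d f z l : f z != 0 -> is_partial d f z l ->
  is_partial d (fun w => (f w)^-1) z (- l * ((f z)^-1 * (f z)^-1)).
Proof.
move=> fz0 [fr fi].
have z0 : z + (0%:C : C) *: real_dir d = z by rewrite scale0r addr0.
(* [N] is |f|^2 along the line; the inverse is the conjugate divided by it, so both of its parts are
   real quotients. *)
pose N := (re_along d f z * re_along d f z) + (im_along d f z * im_along d f z).
have NE : N 0 = complex.Re (f z) ^+ 2 + complex.Im (f z) ^+ 2.
  by rewrite /N /re_along /im_along /= !fctE z0 !expr2.
have N0 : complex.Re (f z) ^+ 2 + complex.Im (f z) ^+ 2 != 0.
  rewrite paddr_eq0 ?sqr_ge0// !sqrf_eq0.
  by move: fz0; rewrite eq_complex.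
have dN : is_derive (0 : R) 1 N (2 * (complex.Re (f z) * complex.Re l +
    complex.Im (f z) * complex.Im l)).
  apply: is_derive_eq; rewrite /re_along /im_along z0 /GRing.scale /=; ring.
rewrite -NE in N0; have dV := is_deriveV N0 dN.
rewrite NE in N0 dV.
split.
- rewrite (_ : re_along _ _ _ = re_along d f z * (fun t => (N t)^-1)); last first.
    by apply/funext => t; rewrite /re_along /= Re_inv !expr2.
  apply: is_derive_eq.
  rewrite /re_along z0 NE ReM ReN ImN ReM ImM Re_inv Im_inv /GRing.scale /=.
  field; exact: N0.
- rewrite (_ : im_along _ _ _ = - (im_along d f z * (fun t => (N t)^-1))); last first.
    by apply/funext => t; rewrite /im_along /= Im_inv !expr2.
  apply: is_derive_eq.
  rewrite /im_along z0 NE ImM ReN ImN ReM ImM Re_inv Im_inv /GRing.scale /=.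
  field; exact: N0.
Qed.

End Partial.

(** * Smooth functions *)

Section Smooth.
Local Open Scope classical_set_scope.
Local Open Scope ring_scope.
Local Open Scope complex_scope.
Context {R : realType} {n : nat}.
Local Notation C := R[i].
Local Notation Cn := 'rV[C]_n.
Implicit Types (d : bool * 'I_n) (f g : Cn -> C) (z : Cn) (l m : C).

Lemma continuous_forD f g z : {for z, continuous f} ->
  {for z, continuous g} -> {for z, continuous (fun w => f w + g w)}.
Proof. move=> cf cg; exact: (@cvgD _ _ _ (nbhs z) _ _ _ _ _ cf cg). Qed.

Lemma continuous_forM f g z : {for z, continuous f} ->
  {for z, continuous g} -> {for z, continuous (fun w => f w * g w)}.
Proof. move=> cf cg; exact: (@cvgM _ _ (nbhs z) _ _ _ _ _ cf cg). Qed.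

Lemma continuous_forV f z : {for z, continuous f} -> f z != 0 ->
  {for z, continuous (fun w => (f w)^-1)}.
Proof. by move=> cf f0; exact: (@cvgV _ _ (nbhs z) _ _ _ f0 cf). Qed.

Lemma continuous_conjc : continuous (@conjc R : C -> C).
Proof.
move=> x; apply/(@cvgrPdist_lt _ _ _ (nbhs (x : C^o)) _) => e e0.
apply/nbhs_ballP; exists e; first by [].
by move=> y; rewrite -ball_normE /= -rmorphB normcJ.
Qed.

Lemma continuous_for_conj f z : {for z, continuous f} ->
  {for z, continuous (fun w => conjc (f w))}.
Proof. by move=> cf; apply: continuous_comp cf _; exact: continuous_conjc. Qed.

(* The partial derivatives of order less than [k] are continuous and have partial
   derivatives; [of_class 0] is no condition. *)
Fixpoint of_class (k : nat) (U : set Cn) (f : Cn -> C) : Prop :=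
  if k is k'.+1 then
    [/\ forall z, U z -> {for z, continuous f},
        forall z d, U z -> partial_ex d f z &
        forall d, of_class k' U (partial d f)]
  else True.

(** Words of derivations would call for Leibniz formulas of every order. The recursion peels off the
    derivation applied first, which is the last letter of the word, so that closure under products
    and inverses becomes a plain induction on the order. *)
Lemma smooth_on_class U f : smooth_on U f <-> forall k, of_class k U f.
Proof.
split=> [sf k|cf w z Uz].
  elim: k f sf => [//|k IHk] f sf; split=> [z Uz|z d Uz|d].
  - by have [] := sf [::] z Uz.
  - by have [_] := sf [::] z Uz.
  - apply: IHk => w z Uz; have := sf (rcons w d) z Uz.
    by rewrite foldr_rcons.
elim/last_ind: w f cf => [|w d IHw] f cf.
  by have [cf1 pf1 _] := cf 1%N; split=> [|d]; [exact: cf1|exact: pf1].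
rewrite foldr_rcons; apply: IHw => k.
by have [_ _] := cf k.+1; exact.
Qed.

Variable U : set Cn.
Hypothesis oU : open U.

(** Openness of [U] turns equality on [U] into equality near each point. This is what replaces a
    partial derivative by its Leibniz expression, known only on [U]. *)
Lemma of_class_eq k f g : (forall z, U z -> f z = g z) ->
  of_class k U f -> of_class k U g.
Proof.
elim: k f g => [//|k IHk] f g fg [cf pf df].
have fgz z : U z -> \near z, f z = g z.
  by move=> Uz; have := open_nbhs_nbhs (conj oU Uz); apply: filterS.
have pg z d : U z -> is_partial d g z (partial d f z).
  by move=> Uz; apply: (is_partial_near (fgz z Uz)); exact/partial_exP/pf.
split=> [z Uz|z d Uz|d].
- rewrite /prop_for /continuous_at -fg//; apply: cvg_trans (cf z Uz).
  apply: (@near_eq_cvg _ _ (nbhs z)); have := fgz z Uz.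
  by apply: filterS => w ->.
- exact: is_partial_ex (pg z d Uz).
- apply: IHk (df d) => z Uz; exact/esym/is_partial_val/pg.
Qed.

Lemma of_classW k f : of_class k.+1 U f -> of_class k U f.
Proof.
elim: k f => [//|k IHk] f [cf pf df]; split=> // d; exact: IHk.
Qed.

Lemma of_class_cst k c : of_class k U (fun=> c).
Proof.
elim: k c => [//|k IHk] c; split=> [z Uz|z d Uz|d].
- exact: cst_continuous.
- exact: is_partial_ex (is_partial_cst d c z).
- apply: of_class_eq (IHk 0) => z _; exact/esym/is_partial_val/is_partial_cst.
Qed.

Lemma of_classD k f g : of_class k U f -> of_class k U g ->
  of_class k U (fun w => f w + g w).
Proof.
elim: k f g => [//|k IHk] f g [cf pf df] [cg pg dg].
have pfg z d : U z -> is_partial d (fun w => f w + g w) z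
    (partial d f z + partial d g z).
  by move=> Uz; apply: is_partialD; apply: partial_exP; auto.
split=> [z Uz|z d Uz|d].
- exact: continuous_forD (cf z Uz) (cg z Uz).
- exact: is_partial_ex (pfg z d Uz).
- apply: of_class_eq (IHk _ _ (df d) (dg d)) => z Uz.
  exact/esym/is_partial_val/pfg.
Qed.

Lemma of_classM k f g : of_class k U f -> of_class k U g ->
  of_class k U (fun w => f w * g w).
Proof.
elim: k f g => [//|k IHk] f g cf0 cg0.
have [[cf pf df] [cg pg dg]] := (cf0, cg0).
have pfg z d : U z -> is_partial d (fun w => f w * g w) z
    (partial d f z * g z + f z * partial d g z).
  by move=> Uz; apply: is_partialM; apply: partial_exP; auto.
split=> [z Uz|z d Uz|d].
- exact: continuous_forM (cf z Uz) (cg z Uz).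
- exact: is_partial_ex (pfg z d Uz).
- apply: of_class_eq (of_classD (IHk _ _ (df d) (of_classW cg0))
    (IHk _ _ (of_classW cf0) (dg d))) => z Uz.
  exact/esym/is_partial_val/pfg.
Qed.

(** The derivative of the inverse involves the inverse itself, but one order lower, where the
    induction hypothesis applies. *)
Lemma of_classV k f : (forall z, U z -> f z != 0) -> of_class k U f ->
  of_class k U (fun w => (f w)^-1).
Proof.
move=> f0; elim: k => [//|k IHk] cf0.
have [cf pf df] := cf0.
have pfV z d : U z -> is_partial d (fun w => (f w)^-1) z
    (- partial d f z * ((f z)^-1 * (f z)^-1)).
  by move=> Uz; apply: is_partialV; [exact: f0|apply: partial_exP; auto].
split=> [z Uz|z d Uz|d].
- exact: continuous_forV (cf z Uz) (f0 z Uz).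
- exact: is_partial_ex (pfV z d Uz).
- have cVk := IHk (of_classW cf0).
  apply: of_class_eq (of_classM (of_classM (of_class_cst k (-1)) (df d))
    (of_classM cVk cVk)) => z Uz.
  by rewrite mulN1r; exact/esym/is_partial_val/pfV.
Qed.

Lemma of_class_conj k f : of_class k U f -> of_class k U (fun w => conjc (f w)).
Proof.
elim: k f => [//|k IHk] f [cf pf df].
have pfJ z d : U z -> is_partial d (fun w => conjc (f w)) z
    (conjc (partial d f z)).
  by move=> Uz; apply: is_partial_conj; apply: partial_exP; auto.
split=> [z Uz|z d Uz|d].
- exact: continuous_for_conj (cf z Uz).
- exact: is_partial_ex (pfJ z d Uz).
- apply: of_class_eq (IHk _ (df d)) => z Uz.
  exact/esym/is_partial_val/pfJ.
Qed.

Lemma smooth_on_eq f g : (forall z, U z -> f z = g z) ->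
  smooth_on U f -> smooth_on U g.
Proof.
by move=> fg /smooth_on_class sf; apply/smooth_on_class => k; apply: of_class_eq (sf k).
Qed.

Lemma smooth_on_cst c : smooth_on U (fun=> c).
Proof. by apply/smooth_on_class => k; exact: of_class_cst. Qed.

Lemma smooth_onD f g : smooth_on U f -> smooth_on U g ->
  smooth_on U (fun w => f w + g w).
Proof.
move=> /smooth_on_class sf /smooth_on_class sg.
by apply/smooth_on_class => k; exact: of_classD.
Qed.

Lemma smooth_onM f g : smooth_on U f -> smooth_on U g ->
  smooth_on U (fun w => f w * g w).
Proof.
move=> /smooth_on_class sf /smooth_on_class sg.
by apply/smooth_on_class => k; exact: of_classM.
Qed.

Lemma smooth_onV f : (forall z, U z -> f z != 0) -> smooth_on U f ->
  smooth_on U (fun w => (f w)^-1).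
Proof.
move=> f0 /smooth_on_class sf.
by apply/smooth_on_class => k; exact: of_classV.
Qed.

Lemma smooth_on_conj f : smooth_on U f -> smooth_on U (fun w => conjc (f w)).
Proof.
by move=> /smooth_on_class sf; apply/smooth_on_class => k; exact: of_class_conj.
Qed.

Lemma smooth_on_partial d f : smooth_on U f -> smooth_on U (partial d f).
Proof.
move=> /smooth_on_class sf; apply/smooth_on_class => k.
by have [_ _ df] := sf k.+1; exact: (df d).
Qed.

Lemma smooth_on_sum (I : Type) (s : seq I) (F : I -> Cn -> C) :
  (forall i, smooth_on U (F i)) -> smooth_on U (fun w => \sum_(i <- s) F i w).
Proof.
move=> sF; elim: s => [|i s IHs].
  by apply: smooth_on_eq (smooth_on_cst 0) => z _; rewrite big_nil.
by apply: smooth_on_eq (smooth_onD (sF i) IHs) => z _; rewrite big_cons.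
Qed.

Lemma smooth_on_prod (I : Type) (s : seq I) (F : I -> Cn -> C) :
  (forall i, smooth_on U (F i)) -> smooth_on U (fun w => \prod_(i <- s) F i w).
Proof.
move=> sF; elim: s => [|i s IHs].
  by apply: smooth_on_eq (smooth_on_cst 1) => z _; rewrite big_nil.
by apply: smooth_on_eq (smooth_onM (sF i) IHs) => z _; rewrite big_cons.
Qed.

Lemma smooth_on_det (m : nat) (A : Cn -> 'M[C]_m) :
  (forall i j, smooth_on U (fun w => A w i j)) -> smooth_on U (fun w => \det (A w)).
Proof.
move=> sA; apply: smooth_on_sum => s.
by apply: smooth_onM; [exact: smooth_on_cst|exact: smooth_on_prod].
Qed.

Lemma smooth_on_invmx (m : nat) (A : Cn -> 'M[C]_m) i j :
  (forall z, U z -> A z \in unitmx) ->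
  (forall i j, smooth_on U (fun w => A w i j)) ->
  smooth_on U (fun w => invmx (A w) i j).
Proof.
move=> uA sA.
apply: (@smooth_on_eq (fun w => (\det (A w))^-1 * cofactor (A w) j i)).
  by move=> z Uz; rewrite /invmx (uA z Uz) !mxE.
apply: smooth_onM.
  by apply: smooth_onV (smooth_on_det sA) => z /uA; rewrite unitmxE unitfE.
rewrite /cofactor; apply: smooth_onM; first exact: smooth_on_cst.
apply: smooth_on_det => k l; apply: smooth_on_eq (sA _ _) => z _.
by rewrite !mxE.
Qed.

Lemma smooth_on_is_partial d f z : smooth_on U f -> U z ->
  is_partial d f z (partial d f z).
Proof. by move=> sf Uz; apply: partial_exP; have [_] := sf [::] z Uz. Qed.

End Smooth.

(** * Symmetry of second derivatives *)

Section MeanValue.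
Local Open Scope classical_set_scope.
Local Open Scope ring_scope.
Local Open Scope complex_scope.
Context {R : realType} {n : nat}.
Local Notation C := R[i].
Local Notation Cn := 'rV[C]_n.
Implicit Types (u : Cn -> R) (v z w : Cn) (d : bool * 'I_n).

Definition line u z v (t : R) : R := u (z + (t%:C : C) *: v).

Definition rderiv v u : Cn -> R := fun w => (line u w v)^`()%classic 0.

Lemma line_shift u z v (s t : R) :
  line u (z + (s%:C : C) *: v) v t = line u z v (s + t).
Proof. by rewrite /line -addrA -scalerDl -rmorphD. Qed.

Lemma is_derive_line u z v (s : R) :
  derivable (line u (z + (s%:C : C) *: v) v) 0 1 ->
  is_derive s 1 (line u z v) (rderiv v u (z + (s%:C : C) *: v)).
Proof.
rewrite /rderiv; set F := line u (z + _) v => dF.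
have -> : line u z v = F \o (fun x => x - s).
  by apply/funext => x; rewrite /F /= line_shift addrC subrK.
have dF' : is_derive (s - s) 1 F (F^`()%classic 0).
  by rewrite subrr derive1E; exact: derivableP.
have ds : is_derive s 1 (fun x : R => x - s) (1 : R).
  by apply: is_derive_eq (subr0 _).
by rewrite -[X in is_derive _ _ _ X]mulr1; exact: is_derive1_comp.
Qed.

Lemma MVT_is_derive (g dg : R -> R) (r : R) : 0 < r ->
  (forall x, 0 <= x <= r -> is_derive x 1 g (dg x)) ->
  exists2 x, 0 <= x <= r & g r - g 0 = dg x * r.
Proof.
move=> r0 gd; have [x xr||x] := @MVT R g dg 0 r r0.
- by apply: gd; move: xr; rewrite in_itv /= => /andP[/ltW-> /ltW->].
- apply: derivable_within_continuous => x; rewrite in_itv /= => /gd xr.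
  exact: ex_derive.
- rewrite in_itv /= subr0 => /andP[/ltW x0 /ltW xr] e; exists x => //.
  by rewrite x0.
Qed.

(** The mean value theorem is applied along [a] to the difference of [u] on two parallel lines, then
    along [b] to [rderiv a u]. The second difference on the left is symmetric in [a] and [b], which
    is the source of Clairaut's theorem. *)
Lemma mean_value_square u z (a b : Cn) (r : R) : 0 < r ->
  let ua := rderiv a u in
  (forall x y : R, 0 <= x <= r -> 0 <= y <= r ->
    let w := z + (x%:C : C) *: a + (y%:C : C) *: b in
    derivable (line u w a) 0 1 /\ derivable (line ua w b) 0 1) ->
  exists x y : R, [/\ 0 <= x <= r, 0 <= y <= r &
    u (z + (r%:C : C) *: a + (r%:C : C) *: b) - u (z + (r%:C : C) *: a)
      - u (z + (r%:C : C) *: b) + u z =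
    rderiv b ua (z + (x%:C : C) *: a + (y%:C : C) *: b) * (r * r)].
Proof.
move=> r0 ua du.
have r0r : 0 <= r <= r by rewrite ltW//=.
have r00 : (0 : R) <= 0 <= r by rewrite (lexx (0 : R)) ltW.
pose g x := line u (z + (r%:C : C) *: b) a x - line u z a x.
pose dg x := ua (z + (x%:C : C) *: a + (r%:C : C) *: b) - ua (z + (x%:C : C) *: a).
have [x xr|x xr gE] := @MVT_is_derive g dg r r0.
  have [d1 _] := du x r xr r0r; have [d2 _] := du x 0 xr r00.
  rewrite scale0r addr0 in d2; rewrite addrAC in d1.
  by apply: is_deriveB; [rewrite addrAC|]; exact: is_derive_line.
pose k y := line ua (z + (x%:C : C) *: a) b y.
have [y yr|y yr kE] := @MVT_is_derive k
    (fun y => rderiv b ua (z + (x%:C : C) *: a + (y%:C : C) *: b)) r r0.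
  by have [_ d1] := du x y xr yr; exact: is_derive_line.
exists x, y; split=> //; rewrite mulrA -kE.
have -> : k r - k 0 = dg x by rewrite /k /line scale0r addr0.
rewrite -gE /g /line scale0r !addr0 [z + (r%:C : C) *: a + _]addrAC; ring.
Qed.

Lemma near_square z (a b : Cn) (P : set Cn) : nbhs z P ->
  exists2 r : R, 0 < r & forall x y : R, 0 <= x <= r -> 0 <= y <= r ->
    P (z + (x%:C : C) *: a + (y%:C : C) *: b).
Proof.
move=> nP.
have cl (c : Cn) : (fun t : R => (t%:C : C) *: c) @ (0 : R) --> (0 : Cn).
  by have := @cvg_real_line R n 0 c; under eq_fun do rewrite add0r.
have : (fun p : R * R => z + (p.1%:C : C) *: a + (p.2%:C : C) *: b) @
    nbhs ((0, 0) : R * R) --> z.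
  have z00 : z + 0 + 0 = z by rewrite !addr0.
  rewrite -[X in _ --> X]z00.
  apply: cvgD; first apply: cvgD.
  - exact: cvg_cst.
  - exact: (@cvg_comp _ _ _ fst (fun t : R => (t%:C : C) *: a) _ _ _ cvg_fst (cl a)).
  - exact: (@cvg_comp _ _ _ snd (fun t : R => (t%:C : C) *: b) _ _ _ cvg_snd (cl b)).
move=> /(_ _ nP) /nbhs_ballP[e /= e0 eP].
exists (e / 2); first exact: divr_gt0.
move=> x y /andP[x0 xe] /andP[y0 ye]; apply: (eP (x, y)).
have e2 : e / 2 < e by lra.
split; rewrite -ball_normE /= sub0r normrN ger0_norm//; lra.
Qed.

Lemma nbhs_setI z (P Q : set Cn) : nbhs z P -> nbhs z Q -> nbhs z (P `&` Q).
Proof. exact: filterI. Qed.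

Lemma nbhs_subset z (P Q : set Cn) : P `<=` Q -> nbhs z P -> nbhs z Q.
Proof. exact: filterS. Qed.

Lemma nbhs_dist_lt u z (e : R) : {for z, continuous u} -> 0 < e ->
  nbhs z (fun w => `|u z - u w| < e).
Proof.
move=> cu e0; have := cu _ (nbhsx_ballx (u z) e e0).
by rewrite /nbhs /= -ball_normE.
Qed.

Lemma dist_le_common (e p q p' q' : R) : p' = q' ->
  `|p - p'| < e / 2 -> `|q - q'| < e / 2 -> `|p - q| <= e.
Proof.
move=> <- hp hq; rewrite (_ : p - q = (p - p') - (q - p')); last by ring.
apply: le_trans (ler_normB _ _) _; apply/ltW; lra.
Qed.

(** Schwarz's argument: in every small square at [z] the two mixed derivatives take a common value,
    possibly at different points, and continuity at [z] makes that value close to both [uab z] and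
    [uba z]. *)
Lemma clairaut_real u z (a b : Cn) (U : set Cn) : open U -> U z ->
  let ua := rderiv a u in let ub := rderiv b u in
  let uab := rderiv b ua in let uba := rderiv a ub in
  (forall w, U w -> [/\ derivable (line u w a) 0 1, derivable (line u w b) 0 1,
     derivable (line ua w b) 0 1 & derivable (line ub w a) 0 1]) ->
  {for z, continuous uab} -> {for z, continuous uba} -> uab z = uba z.
Proof.
move=> oU Uz ua ub uab uba dU cab cba.
apply/eqP; rewrite -subr_eq0 -normr_eq0 eq_le normr_ge0 andbT.
apply/ler_addgt0Pl => e e0; rewrite addr0.
have e20 : 0 < e / 2 by exact: divr_gt0.
pose P := [set w | [/\ U w, `|uab z - uab w| < e / 2 & `|uba z - uba w| < e / 2]].
have nP : nbhs z P.
  have n1 : nbhs z U := open_nbhs_nbhs (conj oU Uz).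
  have n23 := nbhs_setI (nbhs_dist_lt cab e20) (nbhs_dist_lt cba e20).
  by apply: nbhs_subset (nbhs_setI n1 n23) => w [Uw [h1 h2]].
have [r r0 rP] := near_square a b nP.
have [|x [y [xr yr xyE]]] := @mean_value_square u z a b r r0.
  by move=> x y xr yr w; have [/dU[h1 h2 h3 h4] _ _] := rP x y xr yr; exact: conj h1 h3.
have [|y' [x' [yr' xr' yxE]]] := @mean_value_square u z b a r r0.
  move=> y1 x1 yr1 xr1 w; rewrite /w addrAC.
  by have [/dU[h1 h2 h3 h4] _ _] := rP x1 y1 xr1 yr1; exact: conj h2 h4.
clear dU; have rr0 : r * r != 0 by rewrite mulf_neq0// gt_eqF.
have E : uab (z + (x%:C : C) *: a + (y%:C : C) *: b) =
         uba (z + (x'%:C : C) *: a + (y'%:C : C) *: b).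
  apply: (mulIf rr0); apply: etrans (esym xyE) _.
  rewrite (addrAC z (x'%:C *: a)); apply: etrans _ yxE.
  by rewrite (addrAC z (r%:C *: b)); ring.
have [_ h1 _] := rP x y xr yr.
have [_ _ h2] := rP x' y' xr' yr'.
exact: dist_le_common E h1 h2.
Qed.
End MeanValue.

(** * Wirtinger derivatives *)

(* [wirt false j] is d/dz^j and [wirt true j] is d/dzbar^j.  The definition is
   sealed because conversion would otherwise unfold it to limits of difference
   quotients. *)
HB.lock Definition wirt {R : realType} {n : nat} (s : bool) (j : 'I_n)
  (f : 'rV[R[i]]_n -> R[i]) : 'rV[R[i]]_n -> R[i] :=
  if s then dzbar j f else dz j f.

Section Wirtinger.
Local Open Scope classical_set_scope.
Local Open Scope ring_scope.
Local Open Scope complex_scope.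
Context {R : realType} {n : nat}.
Local Notation C := R[i].
Local Notation Cn := 'rV[C]_n.
Implicit Types (f g : Cn -> C) (z w : Cn) (d : bool * 'I_n) (s : bool) (j : 'I_n).

Lemma Re_partial d f w :
  complex.Re (partial d f w) = rderiv (real_dir d) (@complex.Re R \o f) w.
Proof. by []. Qed.

Lemma Im_partial d f w :
  complex.Im (partial d f w) = rderiv (real_dir d) (@complex.Im R \o f) w.
Proof. by []. Qed.

Lemma conjcD (x y : C) : conjc (x + y) = conjc x + conjc y.
Proof. exact: rmorphD. Qed.

Lemma conjcM (x y : C) : conjc (x * y) = conjc x * conjc y.
Proof. exact: rmorphM. Qed.

(** The factor of the y-derivative. One formula then serves both Wirtinger derivatives, and
    conjugation only flips [s]. *)
Definition wcoef s : C := if s then 'i%C else - 'i%C.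

Lemma wirtE s j f z : wirt s j f z =
  2%:R^-1 * (partial (false, j) f z + wcoef s * partial (true, j) f z).
Proof. by rewrite unlock; case: s; rewrite // /dz /wcoef mulNr. Qed.

Lemma conj_wcoef s : conjc (wcoef s) = wcoef (~~ s).
Proof.
by case: s; apply/eqP; rewrite eq_complex /= ?oppr0 ?opprK !eqxx.
Qed.

Variable U : set Cn.
Hypothesis oU : open U.

Section At.
Variable z : Cn.
Hypothesis Uz : U z.

Lemma partial_cst d c : partial d (fun=> c) z = 0.
Proof. exact/is_partial_val/is_partial_cst. Qed.

Lemma partialD d f g : smooth_on U f -> smooth_on U g ->
  partial d (fun w => f w + g w) z = partial d f z + partial d g z.
Proof.
by move=> sf sg; apply/is_partial_val/is_partialD; apply: smooth_on_is_partial Uz.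
Qed.

Lemma partialM d f g : smooth_on U f -> smooth_on U g ->
  partial d (fun w => f w * g w) z = partial d f z * g z + f z * partial d g z.
Proof.
by move=> sf sg; apply/is_partial_val/is_partialM; apply: smooth_on_is_partial Uz.
Qed.

Lemma partial_conj d f : smooth_on U f ->
  partial d (fun w => conjc (f w)) z = conjc (partial d f z).
Proof.
by move=> sf; apply/is_partial_val/is_partial_conj; exact: smooth_on_is_partial sf Uz.
Qed.

Lemma partial_eq d f g : smooth_on U f -> (forall w, U w -> f w = g w) ->
  partial d f z = partial d g z.
Proof.
move=> sf fg; apply/esym/is_partial_val; apply: is_partial_near; last first.
  exact: smooth_on_is_partial sf Uz.
by apply: nbhs_subset (open_nbhs_nbhs (conj oU Uz)).
Qed.

Lemma partial_comm (a b : bool * 'I_n) f : smooth_on U f ->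
  partial a (partial b f) z = partial b (partial a f) z.
Proof.
move=> sf.
have sp c c' := smooth_on_partial c (smooth_on_partial c' sf).
have cp c c' : {for z, continuous (partial c (partial c' f))}.
  by have [] := sp c c' [::] z Uz.
have ex c w g : smooth_on U g -> U w -> partial_ex c g w.
  by move=> sg Uw; have [_] := sg [::] w Uw.
(* [pr] is the real or the imaginary part: the mean value theorem behind Clairaut's theorem holds
   for real values only. *)
have H (pr : C -> R) : continuous pr ->
    (forall d g w, pr (partial d g w) = rderiv (real_dir d) (pr \o g) w) ->
    (forall d g w, partial_ex d g w -> derivable (line (pr \o g) w (real_dir d)) 0 1) ->
    pr (partial a (partial b f) z) = pr (partial b (partial a f) z).
  move=> prc prE prex.
  apply: etrans (prE a (partial b f) z) _.
  apply: etrans _ (esym (prE b (partial a f) z)).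
  have e c : pr \o partial c f = rderiv (real_dir c) (pr \o f).
    by apply/funext => w; exact: prE.
  have e2 c c' : rderiv (real_dir c) (rderiv (real_dir c') (pr \o f)) =
      pr \o partial c (partial c' f).
    by rewrite -e; apply/funext => w; exact/esym/prE.
  apply: etrans (congr1 (fun h => rderiv (real_dir a) h z) (e b)) _.
  apply: etrans _ (esym (congr1 (fun h => rderiv (real_dir b) h z) (e a))).
  apply: (@clairaut_real _ _ _ z (real_dir b) (real_dir a) U oU Uz).
  - move=> w Uw; split.
    + exact/prex/ex.
    + exact/prex/ex.
    + have := prex _ _ _ (ex a w _ (smooth_on_partial b sf) Uw).
      by rewrite (e b).
    + have := prex _ _ _ (ex b w _ (smooth_on_partial a sf) Uw).
      by rewrite (e a).
  - rewrite (e2 a b); exact: (continuous_comp (cp a b) (prc _)).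
  - rewrite (e2 b a); exact: (continuous_comp (cp b a) (prc _)).
have complex_ext (x y : C) : complex.Re x = complex.Re y ->
    complex.Im x = complex.Im y -> x = y.
  by case: x => ? ?; case: y => ? ? /= -> ->.
apply: complex_ext; apply: H.
- exact: continuous_Re.
- exact: Re_partial.
- by move=> d g w [].
- exact: continuous_Im.
- exact: Im_partial.
- by move=> d g w [].
Qed.

Lemma wirt_cst s j c : wirt s j (fun=> c) z = 0.
Proof. by rewrite wirtE !partial_cst mulr0 addr0 mulr0. Qed.

Lemma wirtD s j f g : smooth_on U f -> smooth_on U g ->
  wirt s j (fun w => f w + g w) z = wirt s j f z + wirt s j g z.
Proof. move=> sf sg; rewrite !wirtE. rewrite !(partialD _ sf sg).
move: (partial (false, j) f z) (partial (true, j) f z) (partial (false, j) g z)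
  (partial (true, j) g z) => a b c d; ring. Qed.

Lemma wirtM s j f g : smooth_on U f -> smooth_on U g ->
  wirt s j (fun w => f w * g w) z = wirt s j f z * g z + f z * wirt s j g z.
Proof. move=> sf sg; rewrite !wirtE. rewrite !(partialM _ sf sg).
move: (partial (false, j) f z) (partial (true, j) f z) (partial (false, j) g z)
  (partial (true, j) g z) => a b c d; ring. Qed.

Lemma wirtZ s j c f : smooth_on U f ->
  wirt s j (fun w => c * f w) z = c * wirt s j f z.
Proof.
by move=> sf; rewrite (wirtM _ _ (smooth_on_cst oU c) sf) wirt_cst mul0r add0r.
Qed.

Lemma wirt_conj s j f : smooth_on U f ->
  wirt s j (fun w => conjc (f w)) z = conjc (wirt (~~ s) j f z).
Proof.
move=> sf; rewrite !wirtE !(partial_conj _ sf).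
have h2 : conjc (2%:R^-1 : C) = 2%:R^-1 by rewrite conjc_inv conjc_nat.
by rewrite conjcM conjcD conjcM h2 conj_wcoef negbK.
Qed.

Lemma wirt_eq s j f g : smooth_on U f -> (forall w, U w -> f w = g w) ->
  wirt s j f z = wirt s j g z.
Proof. by move=> sf fg; rewrite !wirtE !(partial_eq _ sf fg). Qed.

Lemma wirt_sum (I : Type) (r : seq I) s j (F : I -> Cn -> C) :
  (forall i, smooth_on U (F i)) ->
  wirt s j (fun w => \sum_(i <- r) F i w) z = \sum_(i <- r) wirt s j (F i) z.
Proof.
move=> sF; elim: r => [|i r IHr].
  rewrite big_nil; apply: etrans _ (wirt_cst s j 0).
  apply/esym/(wirt_eq _ _ (smooth_on_cst oU 0)) => w _.
  by rewrite big_nil.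
rewrite big_cons -IHr -(wirtD _ _ (sF i) (smooth_on_sum oU r sF)).
apply/esym/(wirt_eq _ _ (smooth_onD oU (sF i) (smooth_on_sum oU r sF))) => w _.
by rewrite big_cons.
Qed.
End At.

Lemma smooth_on_wirt s j f : smooth_on U f -> smooth_on U (wirt s j f).
Proof.
move=> sf; apply: (smooth_on_eq oU (f := fun z => 2%:R^-1 *
  (partial (false, j) f z + wcoef s * partial (true, j) f z))) => [z _|].
  by rewrite wirtE.
have sp b : smooth_on U (partial (b, j) f) := smooth_on_partial (b, j) sf.
have h1 := smooth_onM oU (smooth_on_cst oU (wcoef s)) (sp true).
exact: (smooth_onM oU (smooth_on_cst oU 2%:R^-1) (smooth_onD oU (sp false) h1)).
Qed.

Lemma wirt_wirt s t i j f z : U z -> smooth_on U f ->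
  wirt s i (wirt t j f) z = 2%:R^-1 *
  (wirt s i (partial (false, j) f) z + wcoef t * wirt s i (partial (true, j) f) z).
Proof.
move=> Uz sf.
have sp c : smooth_on U (partial c f) := smooth_on_partial c sf.
have sS := smooth_onM oU (smooth_on_cst oU (wcoef t)) (sp (true, j)).
apply: etrans (wirt_eq Uz _ _ (smooth_on_wirt t j sf) (fun w _ => wirtE t j f w)) _.
apply: etrans (wirtZ Uz s i 2%:R^-1 (smooth_onD oU (sp (false, j)) sS)) _.
congr (_ * _); apply: etrans (wirtD Uz s i (sp (false, j)) sS) _.
congr (_ + _); exact: (wirtZ Uz s i (wcoef t) (sp (true, j))).
Qed.

(** Both sides expand bilinearly into the same four pairs of real directions, and each pair commutes
    by [partial_comm]. *)
Lemma wirt_comm s t i j f z : U z -> smooth_on U f ->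
  wirt s i (wirt t j f) z = wirt t j (wirt s i f) z.
Proof.
move=> Uz sf.
have e1 := wirt_wirt s t i j Uz sf.
have e2 := wirt_wirt t s j i Uz sf.
have wE u v (k : 'I_n) (p q : Cn -> C) :
    2%:R^-1 * (wirt u k p z + wcoef v * wirt u k q z) = 2%:R^-1 *
    (2%:R^-1 * (partial (false, k) p z + wcoef u * partial (true, k) p z) +
     wcoef v * (2%:R^-1 * (partial (false, k) q z + wcoef u * partial (true, k) q z))).
  by rewrite !wirtE.
apply: (etrans e1); apply: (etrans _ (esym e2)).
apply: (etrans (wE s t i _ _)); apply: (etrans _ (esym (wE t s j _ _))).
have alg (a b c d a' b' c' d' x y h : C) : a = a' -> b = b' -> c = c' -> d = d' ->
    h * (h * (a + x * b) + y * (h * (c + x * d))) =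
    h * (h * (a' + y * c') + x * (h * (b' + y * d'))).
  by move=> -> -> -> ->; ring.
exact: (alg _ _ _ _ _ _ _ _ _ _ _
  (partial_comm Uz (false, i) (false, j) sf) (partial_comm Uz (true, i) (false, j) sf)
  (partial_comm Uz (false, i) (true, j) sf) (partial_comm Uz (true, i) (true, j) sf)).
Qed.

(** * Functions with vanishing derivatives *)

Lemma const_on_segment (g : R -> R) (c : R) :
  (forall x : R, `|x| <= `|c| -> is_derive x 1 g (0 : R)) -> g c = g 0.
Proof.
move=> gd; have [c0|c0] := leP 0 c.
- have [||x _] := @MVT_segment R g (fun=> 0) 0 c c0.
  + move=> x; rewrite in_itv /= => /andP[x0 xc]; apply: gd.
    by rewrite !ger0_norm// ltW.
  + apply: derivable_within_continuous => x; rewrite in_itv /= => /andP[x0 xc].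
    by apply: ex_derive; apply: gd; rewrite !ger0_norm.
  by rewrite mul0r => /eqP; rewrite subr_eq0 => /eqP.
- have [||x _] := @MVT_segment R g (fun=> 0) c 0 (ltW c0).
  + move=> x; rewrite in_itv /= => /andP[x0 xc]; apply: gd.
    by rewrite !ltr0_norm// lerN2 ltW.
  + apply: derivable_within_continuous => x; rewrite in_itv /= => /andP[x0 xc].
    by apply: ex_derive; apply: gd; rewrite (ltr0_norm c0) (ler0_norm xc) lerN2.
  by rewrite mul0r => /eqP; rewrite subr_eq0 => /eqP.
Qed.

Section Constant.
Variable u : Cn -> R.
Hypothesis du0 : forall w d, U w ->
  derivable (line u w (real_dir d)) 0 1 /\ rderiv (real_dir d) u w = 0.

(** The derivative is known to vanish only along the coordinate directions, so the path is a
    staircase with one edge per direction. Each edge has length at most [r] times the norm of its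
    direction; the radius required around the current corner shrinks accordingly, which keeps the
    whole path in [U]. *)
Lemma constant_along (r : R) (c : bool * 'I_n -> R) : (forall d, `|c d| <= r) ->
  forall (ds : seq (bool * 'I_n)) (w0 : Cn),
  (forall w, `|w - w0| <= r%:C * \sum_(d <- ds) `|real_dir d : Cn| -> U w) ->
  u (w0 + \sum_(d <- ds) ((c d)%:C : C) *: real_dir d) = u w0.
Proof.
move=> cr; elim=> [|d ds IHds] w0 Ur; first by rewrite big_nil addr0.
have r0 : 0 <= r by apply: le_trans (cr d).
have small (x : R) : `|x| <= r ->
    `|(x%:C : C) *: real_dir d : Cn| <= r%:C * `|real_dir d : Cn|.
  by move=> xr; rewrite normrZ normc_real ler_wpM2r// lecR.
rewrite big_cons addrA IHds; last first.
  move=> w wr; apply: Ur; rewrite big_cons mulrDr.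
  have -> : w - w0 = (w - (w0 + ((c d)%:C : C) *: real_dir d)) +
      ((c d)%:C : C) *: real_dir d by rewrite opprD addrA subrK.
  by rewrite (le_trans (ler_normD _ _))// addrC lerD// small.
rewrite -[in RHS](addr0 w0) -[in RHS](scale0r (real_dir d)).
apply: (@const_on_segment (line u w0 (real_dir d)) (c d)) => x xc.
have Ux : U (w0 + (x%:C : C) *: real_dir d).
  apply: Ur; rewrite addrAC subrr add0r big_cons mulrDr.
  rewrite (le_trans (small _ (le_trans xc (cr d))))// lerDl mulr_ge0 ?ler0c//.
  by rewrite sumr_ge0.
have [dx <-] := du0 d Ux.
exact: is_derive_line.
Qed.

Lemma row_real_dirE (v : Cn) : v = \sum_(d : bool * 'I_n)
  ((if d.1 then complex.Im (v 0 d.2) else complex.Re (v 0 d.2))%:C : C) *: real_dir d.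
Proof.
rewrite -(pair_bigA _ (fun b j => ((if b then complex.Im (v 0 j)
  else complex.Re (v 0 j))%:C : C) *: real_dir (b, j))) /= big_bool /= -big_split /=.
rewrite {1}[v]row_sum_delta; apply: eq_bigr => j _.
rewrite /real_dir /= scale1r scalerA -scalerDl addrC mulrC; congr (_ *: _).
exact: complexE.
Qed.

Lemma locally_constant z : U z -> nbhs z (fun w => u w = u z).
Proof.
move=> Uz; have := open_nbhs_nbhs (conj oU Uz).
move=> /nbhs_ballP[e /= /gt0_complexE[e0 eE] eU].
pose M : C := \sum_(d : bool * 'I_n) `|real_dir d : Cn|.
have M0 : 0 <= M by rewrite sumr_ge0.
have ME : M = (complex.Re M)%:C by rewrite RRe_real// ger0_real.
have ReM0 : 0 <= complex.Re M by rewrite -ler0c -ME.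
(* The [+ 1] keeps the divisor positive even if [M = 0] and makes [r * M < e] strict. Norms take
   values in [C], hence the real parts. *)
pose r := complex.Re e / (complex.Re M + 1).
have M1 : 0 < complex.Re M + 1 by rewrite ltr_wpDl.
have r0 : 0 < r by rewrite divr_gt0.
have rM : r%:C * M < e.
  rewrite [X in _ * X < _]ME [X in _ < X]eE -rmorphM ltcR /r mulrAC ltr_pdivrMr//.
  by rewrite ltr_pM2l// ltrDl.
have rC0 : 0 < r%:C :> C by rewrite ltcR.
apply: nbhs_subset (nbhsx_ballx z r%:C rC0) => w zw.
have wj j : `|(w - z) 0 j| <= r%:C.
  have : ball (z 0 j) r%:C (w 0 j) := zw.2 0 j.
  by rewrite -ball_normE /= distrC !mxE => /ltW.
rewrite -[in LHS](subrK z w) addrC [w - z]row_real_dirE.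
apply: (@constant_along r (fun d => if d.1 then complex.Im ((w - z) 0 d.2)
  else complex.Re ((w - z) 0 d.2))).
- move=> [[] j] /=; rewrite -lecR; apply: le_trans (wj j).
    exact: normc_ge_Im.
  exact: normc_ge_Re.
- move=> w' hw'; apply: eU; rewrite -ball_normE /= distrC.
  exact: le_lt_trans hw' rM.
Qed.

End Constant.

(** For a real function the dbar-derivative is the conjugate of the d-derivative, so it vanishes
    too, and the two together determine the x- and y-derivatives. *)
Lemma wirt0_locally_constant (F : Cn -> R) z : U z ->
  smooth_on U (fun w => (F w)%:C) ->
  (forall w j, U w -> wirt false j (fun w => (F w)%:C) w = 0) ->
  nbhs z (fun w => F w = F z).
Proof.
move=> Uz sF F0; apply: locally_constant Uz => w d Uw.
have pex : partial_ex d (fun w => (F w)%:C) w by have [_] := sF [::] w Uw.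
split; first by case: pex.
have F1 j : wirt true j (fun w => (F w)%:C) w = 0.
  have FE : forall v, U v -> (F v)%:C = conjc (F v)%:C :> C.
    by move=> v _; rewrite conjc_real.
  apply: etrans (wirt_eq Uw true j sF FE) _.
  by rewrite (wirt_conj Uw true j sF) /= F0// conjc0.
have := conj (F0 w d.2 Uw) (F1 d.2).
have h2 : 2%:R != 0 :> C by rewrite pnatr_eq0.
have w0 : wcoef true != 0 by rewrite /wcoef eq_complex /= oner_eq0 andbF.
have alg (p q : C) : 2%:R^-1 * (p + wcoef false * q) = 0 ->
    2%:R^-1 * (p + wcoef true * q) = 0 -> p = 0 /\ q = 0.
  move=> /eqP; rewrite mulf_eq0 invr_eq0 (negPf h2) /= => /eqP e0.
  move=> /eqP; rewrite mulf_eq0 invr_eq0 (negPf h2) /= => /eqP e1.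
  have p0 : p = 0.
    by apply: (mulfI h2); rewrite mulr0 -[RHS](addr0 0) -{1}e0 -e1 /wcoef; ring.
  split=> //; move/eqP: e1; rewrite p0 add0r mulf_eq0 (negPf w0) /=.
  by move/eqP.
move=> [e0 e1]; have [p0 q0] := alg _ _ (etrans (esym (wirtE _ _ _ _)) e0)
  (etrans (esym (wirtE _ _ _ _)) e1).
case: d p0 q0 {pex F1 alg e0 e1} => -[] j p0 q0.
- by have := congr1 (@complex.Re R) q0; rewrite Re_partial.
- by have := congr1 (@complex.Re R) p0; rewrite Re_partial.
Qed.

End Wirtinger.

(** * Lefschetz contraction *)

Section Lefschetz.
Local Open Scope ring_scope.
Context {K : numFieldType} {V : lmodType K} {n : nat}.
Context (E H I J : 'I_n -> {linear V -> V}) (v : V).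
(* [E] and [H] multiply by the covectors [e_i] and [h_i] of a frame adapted to
   the 2-form [\sum_i e_i /\ h_i], [I] and [J] are the dual contractions, and
   [F] multiplies by the covectors of a second frame of the span of the [h_i]. *)
Hypothesis EE : forall i j x, E i (E j x) = - E j (E i x).
Hypothesis HH : forall i j x, H i (H j x) = - H j (H i x).
Hypothesis EH : forall i j x, E i (H j x) = - H j (E i x).
Hypothesis IE : forall i j x, I i (E j x) = (i == j)%:R *: x - E j (I i x).
Hypothesis JH : forall i j x, J i (H j x) = (i == j)%:R *: x - H j (J i x).
Hypothesis IH : forall i j x, I i (H j x) = - H j (I i x).
Hypothesis JE : forall i j x, J i (E j x) = - E j (J i x).
Context (F : 'I_n -> {linear V -> V}) (e : 'I_n -> 'I_n -> K).
Hypothesis FH : forall k x, F k x = \sum_i e i k *: H i x.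
Hypothesis HF : forall i j x, H i (F j x) = - F j (H i x).
Hypothesis EF : forall i j x, E i (F j x) = - F j (E i x).
Hypothesis IF : forall i j x, I i (F j x) = - F j (I i x).
Hypothesis JF : forall i j x, J i (F j x) = e i j *: x - F j (J i x).
Hypothesis Iv : forall i, I i v = 0.
Hypothesis Jv : forall i, J i v = 0.

(** The Lefschetz triple: [L] multiplies by the 2-form, [Lam] is the dual contraction, and [N]
    multiplies a homogeneous form by its degree. *)
Let L x := \sum_i E i (H i x).
Let Lam x := \sum_i J i (I i x).
Let N x := \sum_i (E i (I i x) + H i (J i x)).

Lemma sum_delta (G : 'I_n -> V) k : \sum_i (i == k)%:R *: G i = G k.
Proof.
rewrite (bigD1 k)//= eqxx scale1r big1 ?addr0// => i /negPf->.
by rewrite scale0r.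
Qed.

Let L0 : L 0 = 0. Proof. by rewrite /L big1// => i _; rewrite !linear0. Qed.
Let Lam0 : Lam 0 = 0. Proof. by rewrite /Lam big1// => i _; rewrite !linear0. Qed.
Let LD x y : L (x + y) = L x + L y.
Proof. by rewrite /L -big_split; apply: eq_bigr => i _; rewrite !linearD. Qed.
Let LZ c x : L (c *: x) = c *: L x.
Proof. by rewrite /L scaler_sumr; apply: eq_bigr => i _; rewrite !linearZ. Qed.
Let LamD x y : Lam (x + y) = Lam x + Lam y.
Proof. by rewrite /Lam -big_split; apply: eq_bigr => i _; rewrite !linearD. Qed.
Let LamZ c x : Lam (c *: x) = c *: Lam x.
Proof. by rewrite /Lam scaler_sumr; apply: eq_bigr => i _; rewrite !linearZ. Qed.
Let ND x y : N (x + y) = N x + N y.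
Proof.
rewrite /N -big_split; apply: eq_bigr => i _; rewrite !linearD /=.
by rewrite addrACA.
Qed.
Let NZ c x : N (c *: x) = c *: N x.
Proof.
by rewrite /N scaler_sumr; apply: eq_bigr => i _; rewrite !linearZ -scalerDr.
Qed.
Let N0 : N 0 = 0.
Proof. by rewrite /N big1// => i _; rewrite !linear0 addr0. Qed.

Let NE k x : N (E k x) = E k x + E k (N x).
Proof.
rewrite /N -[X in _ = X + _](sum_delta (fun i => E i x)) linear_sum -big_split.
apply: eq_bigr => i _ /=.
rewrite IE JE linearB linearZ /= linearN /= [E i (E k _)]EE opprK.
by rewrite linearD /= [E k (H i _)]EH addrA.
Qed.

Let NH k x : N (H k x) = H k x + H k (N x).
Proof.
rewrite /N -[X in _ = X + _](sum_delta (fun i => H i x)) linear_sum -big_split.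
apply: eq_bigr => i _ /=.
rewrite IH JH linearB linearZ /= linearN /= [H i (H k _)]HH opprK.
by rewrite [E i (H k _)]EH opprK linearD addrCA.
Qed.

Let NF k x : N (F k x) = F k x + F k (N x).
Proof.
rewrite /N [X in _ = X + _]FH linear_sum -big_split.
apply: eq_bigr => i _ /=.
rewrite IF JF linearB linearZ /= linearN /= HF opprK.
by rewrite [E i (F k _)]EF opprK linearD addrCA.
Qed.

Let NL x : N (L x) = 2%:R *: L x + L (N x).
Proof.
rewrite {1}/L (big_morph N ND N0) /L scaler_sumr -big_split.
apply: eq_bigr => i _; rewrite NE NH linearD addrA /=; congr (_ + _).
by rewrite -mulr2n scaler_nat.
Qed.

(** When [J i] and [I i] move past [E k] and [H k], extra terms appear only for [i = k], and they
    add up to [x - E k (I k x) - H k (J k x)]. Summed over [k], this is [n - N]. *)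
Let LamL x : Lam (L x) = L (Lam x) + n%:R *: x - N x.
Proof.
have nE : n%:R *: x = \sum_(k < n) x.
  by rewrite sumr_const card_ord scaler_nat.
have LLam : L (Lam x) = \sum_k \sum_i E k (H k (J i (I i x))).
  by apply: eq_bigr => k _; rewrite !linear_sum.
rewrite LLam nE -addrA -sumrB -big_split {1}/L (big_morph Lam LamD Lam0).
apply: eq_bigr => k _ /=.
rewrite -(sum_delta (fun i => x - (E k (I i x) + H k (J i x))) k) -big_split /=.
apply: eq_bigr => i _; rewrite IE IH linearN opprK linearD linearZ /= JE !JH.
rewrite linearB linearZ /=; case: eqVneq => [->|_]; last first.
  by rewrite !scale0r subr0 !sub0r linearN opprK addr0.
rewrite /= !scale1r linearB /= opprB opprD -!addrA [RHS]addrCA; congr (_ + _).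
by rewrite addrC -addrA.
Qed.

Let N_iter p x k : N x = p%:R *: x -> N (iter k L x) = (p + k.*2)%:R *: iter k L x.
Proof.
move=> Nx; elim: k => [|k IHk] /=; first by rewrite addn0.
by rewrite NL IHk LZ -scalerDl -natrD doubleS !addnS add2n.
Qed.

(** Each passage of [Lam] through a factor [L] costs [n] minus the current degree; the sum of
    [n - p - 2 j] over [j <= k] is the stated coefficient. *)
Let Lam_iter p x k : N x = p%:R *: x -> Lam (iter k.+1 L x) =
  iter k.+1 L (Lam x) + (k.+1%:R * (n%:R - p%:R - k%:R)) *: iter k L x.
Proof.
move=> Nx; elim: k => [|k IHk].
  idtac; rewrite /= LamL Nx mul1r subr0 scalerBl -addrA.
  by rewrite addrA.
rewrite iterS LamL IHk LD LZ (N_iter _ Nx) -!iterS -!addrA; congr (_ + _).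
rewrite -scalerBl -scalerDl; congr (_ *: _).
rewrite -addnn !natrD -[k.+2%:R]natr1 -[k.+1%:R]natr1; ring.
Qed.

Variables (B C : 'I_n -> 'I_n -> 'I_n -> K).
(** The shape of [d omega]: [B] holds the d-derivatives of the coefficients and [C] the
    dbar-derivatives. The factors [F] allow coefficients with respect to [dzbar^j] instead of the
    adapted frame. *)
Let a := \sum_k \sum_i \sum_j
  (B k i j *: E k (E i (F j v)) + C k i j *: F k (E i (F j v))).
Let b := \sum_k \sum_i \sum_j
  (B k i j *: (e i j *: E k v - e k j *: E i v) +
   C k i j *: (e i j *: F k v - e i k *: F j v)).

Let f_sum3 (f : V -> V) (f0 : f 0 = 0) (fD : {morph f : x y / x + y})
  (G : 'I_n -> 'I_n -> 'I_n -> V) :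
  f (\sum_k \sum_i \sum_j G k i j) = \sum_k \sum_i \sum_j f (G k i j).
Proof.
rewrite (big_morph f fD f0); apply: eq_bigr => k _.
rewrite (big_morph f fD f0); apply: eq_bigr => i _.
by rewrite (big_morph f fD f0).
Qed.

Let Nv : N v = 0.
Proof. by rewrite /N big1// => i _; rewrite Iv Jv !linear0 addr0. Qed.

Let Na : N a = 3%:R *: a.
Proof.
have three (x : V) : x + (x + x) = 3%:R *: x.
  by rewrite scaler_nat !mulrS mulr0n addr0.
rewrite /a (f_sum3 N0 ND) (f_sum3 (f := GRing.scale 3%:R)); last 2 first.
- by rewrite scaler0.
- by move=> x y; rewrite scalerDr.
apply: eq_bigr => k _; apply: eq_bigr => i _; apply: eq_bigr => j _.
rewrite ND !NZ.
have -> : N (E k (E i (F j v))) = 3%:R *: E k (E i (F j v)).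
  by rewrite !NE NF Nv linear0 addr0 linearD /= three.
have -> : N (F k (E i (F j v))) = 3%:R *: F k (E i (F j v)).
  by rewrite NF NE NF Nv linear0 addr0 linearD /= three.
by rewrite scalerDr !scalerA ![_ * 3%:R]mulrC.
Qed.

Let Lam_a : Lam a = b.
Proof.
rewrite /a /b (f_sum3 Lam0 LamD).
apply: eq_bigr => k _; apply: eq_bigr => i _; apply: eq_bigr => j _.
rewrite LamD !LamZ; congr (_ *: _ + _ *: _); rewrite /Lam.
- transitivity (\sum_l ((l == k)%:R *: J l (E i (F j v)) -
                       (l == i)%:R *: J l (E k (F j v)))).
    apply: eq_bigr => l _.
    by rewrite !(IE, IF, Iv) !(linear0, oppr0, subr0, linearB, linearZ).
  rewrite sumrB !sum_delta !(JE, JF, Jv) !(linear0, subr0, linearZ) /= opprK.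
  by rewrite addrC scalerN.
- transitivity (\sum_l - ((l == i)%:R *: J l (F k (F j v)))).
    apply: eq_bigr => l _.
    by rewrite !(IE, IF, Iv) !(linear0, oppr0, subr0, linearN, linearZ).
  rewrite sumrN sum_delta !(JF, Jv) !(linear0, subr0, linearZ) /=.
  by rewrite opprD !scalerN opprK addrC.
Qed.

Let Nb : N b = 1%:R *: b.
Proof.
have NN x : N (- x) = - N x by rewrite -scaleN1r NZ scaleN1r.
have NEv k : N (E k v) = E k v by rewrite NE Nv linear0 addr0.
have NFv k : N (F k v) = F k v by rewrite NF Nv linear0 addr0.
rewrite scale1r /b (f_sum3 N0 ND).
apply: eq_bigr => k _; apply: eq_bigr => i _; apply: eq_bigr => j _.
by rewrite !(ND, NN, NZ, NEv, NFv).
Qed.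

Let Lam_b : Lam b = 0.
Proof.
have LN x : Lam (- x) = - Lam x by rewrite -scaleN1r LamZ scaleN1r.
have LE k : Lam (E k v) = 0.
  by rewrite /Lam big1// => i _; rewrite IE Iv linear0 subr0 linearZ /= Jv scaler0.
have LF k : Lam (F k v) = 0.
  by rewrite /Lam big1// => i _; rewrite IF Iv !(linear0, oppr0).
rewrite /b (f_sum3 Lam0 LamD) big1// => k _; rewrite big1// => i _.
rewrite big1// => j _.
by rewrite !(LamD, LN, LamZ, LE, LF) !(oppr0, scaler0, addr0).
Qed.

(* [Lam] is the contraction of the Lefschetz sl_2-triple, so the vanishing of
   [L^(n-2)] on the 3-form [a] passes to [L^(n-1)] on the 1-form [Lam a], on
   which [L^(n-1)] is injective. *)
Lemma lefschetz_contraction : (2 <= n)%N -> iter n.-2 L a = 0 -> b = 0.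
Proof.
move=> n2 La0.
have La1 : iter n.-1 L b = 0.
  have nE : n.-1 = n.-2.+1 by case: n n2 => [|[]].
  have := Lam_iter n.-2 Na; rewrite Lam_a -nE La0 scaler0 addr0 => <-.
  by rewrite nE iterS La0 L0 Lam0.
have : forall k, (k <= n.-1)%N -> iter k L b = 0 -> b = 0.
  elim=> [//|k IHk] kn Lk; apply: IHk; first exact: ltnW.
  have := Lam_iter k Nb; rewrite Lam_b Lk Lam0.
  have -> : iter k.+1 L 0 = 0 by elim: k.+1 => [//|m /= ->].
  rewrite add0r => /esym/eqP; rewrite scaler_eq0 mulf_eq0 pnatr_eq0 /=.
  (* For degree 1 the coefficient is [(k + 1) (n - 1 - k)], nonzero because [k + 1 <= n - 1]; hence
     one power of [L] can be removed. *)
  rewrite -addrA -opprD -natrD -natrB ?add1n; last by lia.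
  by rewrite pnatr_eq0 => /orP[|/eqP//]; lia.
by move/(_ _ (leqnn _) La1).
Qed.
End Lefschetz.

(** * Exterior multiplication and contraction *)

Section Covectors.
Local Open Scope ring_scope.
Context {K : numFieldType} {N : nat}.
Local Notation V := ({set 'I_N} -> K^o).
Implicit Types (a b : 'I_N) (S : {set 'I_N}) (x y : V).

(** The Jordan--Wigner sign: the parity of the number of elements of [S] that the [a]-th covector
    passes on its way to its sorted place. *)
Definition sorting_sign a S : K := \prod_(c in S) (-1) ^+ (c < a)%N.

Lemma sorting_sign_setD1 a b S : b \in S ->
  sorting_sign a S = (-1) ^+ (b < a)%N * sorting_sign a (S :\ b)%SET.
Proof. by move=> bS; rewrite /sorting_sign (big_setD1 b). Qed.

Lemma sorting_sign_setU1 a b S : b \notin S ->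
  sorting_sign a (b |: S)%SET = (-1) ^+ (b < a)%N * sorting_sign a S.
Proof. by move=> bS; rewrite /sorting_sign big_setU1. Qed.

Lemma sorting_signK a S : sorting_sign a S * sorting_sign a S = 1.
Proof.
rewrite /sorting_sign -big_split big1//= => c _.
by rewrite -signr_addb addbb.
Qed.

Lemma sign_ltnN a b : a != b -> (-1) ^+ (a < b)%N = - (-1) ^+ (b < a)%N :> K.
Proof. by rewrite -val_eqE /=; case: ltngtP; rewrite ?expr0 ?expr1 ?opprK. Qed.

(* Functions of subsets of ['I_N] encode alternating forms as in [Defs.form]:
   [cre a] multiplies on the left by the [a]-th covector, and [ann a] contracts
   with the dual vector. *)
Definition cre a x : V := fun S =>
  if a \in S then sorting_sign a (S :\ a)%SET * x (S :\ a)%SET else 0.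

Definition ann a x : V := fun S =>
  if a \in S then 0 else sorting_sign a S * x (a |: S)%SET.

Fact cre_is_linear a : linear (cre a).
Proof.
move=> k x y; apply/funext => S; rewrite /cre !fctE.
case: ifP => _; last by rewrite scaler0 addr0.
by rewrite /GRing.scale /= mulrDr mulrCA.
Qed.

Fact ann_is_linear a : linear (ann a).
Proof.
move=> k x y; apply/funext => S; rewrite /ann !fctE.
case: ifP => _; first by rewrite scaler0 addr0.
by rewrite /GRing.scale /= mulrDr mulrCA.
Qed.

HB.instance Definition _ a := GRing.isLinear.Build K V V *:%R (cre a) (cre_is_linear a).
HB.instance Definition _ a := GRing.isLinear.Build K V V *:%R (ann a) (ann_is_linear a).

(** Both orders of removal leave the same set, and the signs differ by one transposition because
    exactly one of [a < b] and [b < a] holds. If [a = b], the second removal finds nothing. *)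
Lemma cre_anticomm a b x : cre a (cre b x) = - cre b (cre a x).
Proof.
apply/funext => S; rewrite opprfctE /cre !finset.in_setD1.
have [->|ab] := eqVneq a b.
  by rewrite /= !mulr0 if_same oppr0.
rewrite /=.
case aS: (a \in S); case bS: (b \in S); rewrite ?mulr0 ?oppr0//.
have -> : ((S :\ b) :\ a)%SET = ((S :\ a) :\ b)%SET by rewrite !finset.setDDl finset.setUC.
rewrite (sorting_sign_setD1 a (_ : b \in (S :\ a)%SET)); last by rewrite !inE eq_sym ab.
rewrite (sorting_sign_setD1 b (_ : a \in (S :\ b)%SET)); last by rewrite !inE ab.
have -> : ((S :\ b) :\ a)%SET = ((S :\ a) :\ b)%SET by rewrite !finset.setDDl finset.setUC.
rewrite (sign_ltnN ab); ring.
Qed.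

(** For [a = b] exactly one of the two compositions is nonzero at [S], according to whether [a] lies
    in [S], and there the sign occurs squared. *)
Lemma ann_cre a b x : ann a (cre b x) = (a == b)%:R *: x - cre b (ann a x).
Proof.
apply/funext => S; rewrite !fctE /ann /cre /GRing.scale /=.
have [<-|ab] := eqVneq a b.
  rewrite mul1r !inE eqxx /=; case: ifPn => aS.
    rewrite finset.setD1K// mulrA sorting_signK mul1r subrr//.
  by rewrite finset.setU1K// mulrA sorting_signK mul1r subr0.
rewrite mul0r sub0r !inE ab (eq_sym b a) (negPf ab) /=.
case aS: (a \in S); case bS: (b \in S); rewrite ?mulr0 ?oppr0//.
have -> : ((a |: S) :\ b)%SET = (a |: (S :\ b))%SET.
  apply/finset.setP => c; rewrite !inE.
  by case: (eqVneq c a) => [->|]//=; rewrite ab.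
rewrite sorting_sign_setU1 ?inE ?aS ?andbF// (sorting_sign_setD1 a bS).
have ss : (-1) ^+ (b < a)%N * (-1) ^+ (b < a)%N = 1 :> K by rewrite -signr_addb addbb.
rewrite (sign_ltnN ab); ring: ss.
Qed.

(** The unit of the exterior algebra, which is [form1] at a point; powers of the 2-form are built on
    it. *)
Definition vac : V := fun S => (S == finset.set0)%:R.

Lemma ann_vac a : ann a vac = 0.
Proof.
apply/funext => S; rewrite /ann /vac; case: ifP => // _.
by case: eqP => [/finset.setP/(_ a)|_]; rewrite ?mulr0// !inE eqxx.
Qed.

Lemma cre_vac a S : cre a vac S = (S == [set a]%SET)%:R.
Proof.
rewrite /cre /vac; case: ifPn => aS.
  rewrite -[S in RHS](finset.setD1K aS).
  have [->|/finset.set0Pn[c]] := eqVneq (S :\ a)%SET finset.set0.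
    by rewrite /sorting_sign big_set0 finset.setU0 eqxx mul1r.
  move=> cS; case: eqP => [E|]; last by rewrite mulr0.
  have : c \in [set a]%SET by rewrite -E finset.in_setU cS orbT.
  by move: cS; rewrite !inE => /andP[/negPf->].
by case: eqP => // E; move: aS; rewrite E finset.set11.
Qed.
End Covectors.

(** * The Lefschetz contraction in a coordinate coframe *)

Section TorsionTrace.
Local Open Scope ring_scope.
Context {K : numFieldType} {n : nat}.
Local Notation V := ({set 'I_(n + n)} -> K^o).

(** Supplies the adapted frame [eta_i = sum_j c i j dzbar^j] and its dual contractions. *)
Definition lincomb (c : 'I_n -> K) (G : 'I_n -> {linear V -> V}) (x : V) : V :=
  \sum_j c j *: G j x.

Fact lincomb_is_linear c G : linear (lincomb c G).
Proof.
move=> k x y; rewrite /lincomb scaler_sumr -big_split; apply: eq_bigr => j _ /=.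
by rewrite linearD linearZ scalerDr !scalerA mulrC.
Qed.

HB.instance Definition _ c G :=
  GRing.isLinear.Build K V V *:%R (lincomb c G) (lincomb_is_linear c G).

Local Notation El i := (cre (lshift n i) : {linear V -> V}).
Local Notation Er j := (cre (rshift n j) : {linear V -> V}).
Local Notation Il i := (ann (lshift n i) : {linear V -> V}).
Local Notation Ir j := (ann (rshift n j) : {linear V -> V}).

Lemma lincomb_anticomm (c : 'I_n -> K) (G : 'I_n -> {linear V -> V})
    (P : {linear V -> V}) x :
  (forall j y, P (G j y) = - G j (P y)) -> P (lincomb c G x) = - lincomb c G (P x).
Proof.
move=> PG; rewrite /lincomb linear_sum -sumrN; apply: eq_bigr => j _.
by rewrite linearZ /= PG scalerN.
Qed.

(** With [eta_i = sum_j c i j dzbar^j] the 2-form is [sum_i dz^i /\ eta_i], so nothing has to be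
    diagonalised. As [d] inverts [c], one has [dzbar^j = sum_i d j i eta_i]; this is the matrix [e]
    of [lefschetz_contraction]. *)
Lemma torsion_trace (n2 : (2 <= n)%N) (c d : 'I_n -> 'I_n -> K)
  (cd : forall i k, \sum_j c k j * d j i = (i == k)%:R)
  (dc : forall k j, \sum_i d k i * c i j = (j == k)%:R)
  (B C : 'I_n -> 'I_n -> 'I_n -> K) :
  let L x := \sum_i \sum_j c i j *: El i (Er j x) in
  iter n.-2 L (\sum_k \sum_i \sum_j
    (B k i j *: El k (El i (Er j vac)) + C k i j *: Er k (El i (Er j vac)))) = 0 ->
  forall m, \sum_i \sum_j (B m i j - B i m j) * d j i = 0.
Proof.
move=> L La m.
pose H i : {linear V -> V} := lincomb (c i) (fun j => Er j).
pose J i : {linear V -> V} := lincomb (fun j => d j i) (fun j => Ir j).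
have lr (i j : 'I_n) : (lshift n i == rshift n j) = false.
  by apply/eqP => /(congr1 val) /=; have := ltn_ord i; lia.
have IrEr i j x : Ir i (Er j x) = (i == j)%:R *: x - Er j (Ir i x).
  by rewrite /= ann_cre (inj_eq (@rshift_inj _ _)).
have JF i j x : J i (Er j x) = d j i *: x - Er j (J i x).
  transitivity (\sum_l ((l == j)%:R *: (d l i *: x) - Er j (d l i *: Ir l x))).
    apply: eq_bigr => l _; rewrite IrEr scalerBr; congr (_ - _).
      by rewrite !scalerA mulrC.
    by rewrite linearZ.
  by rewrite sumrB (sum_delta (fun l => d l i *: x)) -linear_sum.
have HF i j x : H i (Er j x) = - Er j (H i x).
  have -> : Er j (H i x) = - H i (Er j x).
    by apply: (@lincomb_anticomm (c i) (fun j => Er j) (Er j) x) => l y; exact: cre_anticomm.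
  by rewrite opprK.
have JHd i j x : J i (H j x) = (i == j)%:R *: x - H j (J i x).
  have -> : J i (H j x) = \sum_l c j l *: J i (Er l x).
    rewrite -[H j x]/(\sum_l c j l *: Er l x) linear_sum; apply: eq_bigr => l _.
    by rewrite linearZ.
  transitivity (\sum_l ((c j l * d l i) *: x - c j l *: Er l (J i x))).
    by apply: eq_bigr => l _; rewrite JF scalerBr scalerA.
  by rewrite sumrB -scaler_suml cd.
have b0 : \sum_k \sum_i \sum_j
    (B k i j *: (d j i *: El k vac - d j k *: El i vac) +
     C k i j *: (d j i *: Er k vac - d k i *: Er j vac)) = 0.
  have LE : L = (fun x => \sum_i El i (H i x)).
    apply/funext => x; apply: eq_bigr => i _.
    rewrite -[H i x]/(\sum_j c i j *: Er j x) linear_sum; apply: eq_bigr => j _.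
    by rewrite linearZ.
  rewrite LE in La.
  apply: (@lefschetz_contraction K V n (fun i => El i) H (fun i => Il i) J vac
    _ _ _ _ _ _ _ (fun j => Er j) (fun i j => d j i) _ _ _ _ _ _ _ B C n2 La).
  - by move=> i j x; exact: cre_anticomm.
  - move=> i j x.
    by apply: (@lincomb_anticomm (c j) (fun j => Er j) (H i) x) => l y; exact: HF.
  - move=> i j x.
    by apply: (@lincomb_anticomm (c j) (fun j => Er j) (El i) x) => l y; exact: cre_anticomm.
  - by move=> i j x; rewrite /= ann_cre (inj_eq (@lshift_inj _ _)).
  - exact: JHd.
  - move=> i j x; apply: (@lincomb_anticomm (c j) (fun j => Er j) (Il i) x) => l y.
    by rewrite /= ann_cre lr scale0r sub0r.
  - move=> i j x; have -> : El j (J i x) = - J i (El j x); last by rewrite opprK.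
    apply: (@lincomb_anticomm (d^~ i) (fun j => Ir j) (El j) x) => l y.
    by rewrite /= ann_cre eq_sym lr scale0r sub0r opprK.
  - move=> k x; rewrite /= /lincomb.
    under eq_bigr do rewrite scaler_sumr.
    rewrite exchange_big /=.
    under eq_bigr => j _ do under eq_bigr => i _ do rewrite scalerA.
    under eq_bigr => j _ do rewrite -scaler_suml dc.
    by rewrite (sum_delta (fun j => Er j x)).
  - exact: HF.
  - by move=> i j x; exact: cre_anticomm.
  - by move=> i j x; rewrite /= ann_cre lr scale0r sub0r.
  - exact: JF.
  - by move=> i; exact: ann_vac.
  - by move=> i; rewrite /= /lincomb big1// => j _ /=; rewrite ann_vac scaler0.
(* Evaluating at the singleton of [dz^m] reads off the [dz^m] coefficient and discards the [dzbar]
   terms, hence all of [C]. *)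
have vacE (k : 'I_n) : (El k vac : V) [set lshift n m]%SET = (k == m)%:R.
  rewrite /= cre_vac (inj_eq finset.set1_inj) eq_sym.
  by rewrite (inj_eq (@lshift_inj _ _)).
have vacF (k : 'I_n) : (Er k vac : V) [set lshift n m]%SET = 0.
  by rewrite /= cre_vac (inj_eq finset.set1_inj) lr.
have sumE (G : 'I_n -> V) S : (\sum_i G i) S = \sum_i G i S.
  by elim/big_rec2: _ => // i y1 y2 _ <-; rewrite fctE.
have := congr1 (fun x : V => x [set lshift n m]%SET) b0.
rewrite sumE; under eq_bigr do rewrite sumE.
under eq_bigr => k _ do under eq_bigr => i _ do rewrite sumE.
move=> b1; transitivity (\sum_k \sum_i \sum_j
  ((k == m)%:R * (B k i j * d j i) - (i == m)%:R * (B k i j * d j k))); last first.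
  rewrite -[RHS]b1; do 3!(apply: eq_bigr => ? _).
  rewrite !fctE vacE vacF vacE vacF /GRing.scale /=; ring.
have sumd (G : 'I_n -> K) k : \sum_i (i == k)%:R * G i = G k.
  exact: (@sum_delta K K^o n G k).
have -> : \sum_k \sum_i \sum_j
  ((k == m)%:R * (B k i j * d j i) - (i == m)%:R * (B k i j * d j k)) =
  (\sum_k (k == m)%:R * \sum_i \sum_j (B k i j * d j i)) -
  (\sum_k \sum_i (i == m)%:R * \sum_j (B k i j * d j k)).
  rewrite -sumrB; apply: eq_bigr => k _; rewrite mulr_sumr -sumrB.
  by apply: eq_bigr => i _; rewrite !mulr_sumr -sumrB.
rewrite sumd -sumrB; apply: eq_bigr => i _; rewrite sumd -sumrB.
by apply: eq_bigr => j _; rewrite mulrBl.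
Qed.
End TorsionTrace.

(** * The trace of the torsion of a balanced metric *)

Section Wedge.
Local Open Scope ring_scope.
Local Open Scope complex_scope.
Context {R : realType} {n : nat}.
Local Notation C := R[i].
Local Notation Cn := 'rV[C]_n.
Local Notation V := ({set 'I_(n + n)} -> C^o).
Local Notation El i := (cre (lshift n i) : {linear V -> V}).
Local Notation Er j := (cre (rshift n j) : {linear V -> V}).

Lemma shuffle_signE (A B : {set 'I_(n + n)}) :
  shuffle_sign A B = \prod_(a in A) sorting_sign a B :> C.
Proof.
rewrite /shuffle_sign -sum1_card (eq_bigl (fun ab => (ab.1 \in A) && (ab.2 \in B) &&
  (ab.2 < ab.1)%N)); last by move=> ab; rewrite !inE.
rewrite big_mkcondr /= -(pair_big_dep (fun a => a \in A) (fun _ b => b \in B)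
  (fun a b => if (b < a)%N then 1%N else 0%N)) /= GRing.expr_sum.
apply: eq_bigr => a _; rewrite GRing.expr_sum; apply: eq_bigr => b _.
by case: ifP.
Qed.

Lemma lshift_neq_rshift (i j : 'I_n) : (lshift n i == rshift n j) = false.
Proof. by apply/eqP => /(congr1 val) /=; have := ltn_ord i; lia. Qed.

(* Multiplication by the 2-form [\sum_(i, j) c i j dz^i /\ dzbar^j]. *)
Definition Lop (c : 'I_n -> 'I_n -> C) (x : V) : V :=
  \sum_i \sum_j c i j *: El i (Er j x).

Lemma sum_fctE (I : Type) (r : seq I) (G : I -> V) S :
  (\sum_(i <- r) G i) S = \sum_(i <- r) G i S.
Proof. by elim/big_rec2: _ => // i y1 y2 _ <-; rewrite fctE. Qed.

Lemma LopE c x S : Lop c x S = \sum_i \sum_j c i j * El i (Er j x) S.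
Proof. by rewrite /Lop sum_fctE; apply: eq_bigr => i _; rewrite sum_fctE. Qed.

(** In the sum over subsets of [S], the term indexed by [i, j] survives only at the pair of [dz^i]
    and [dzbar^j], where the shuffle sign splits into two sorting signs. *)
Lemma wedge_fundamental (h : Cn -> 'M[C]_n) (a : @Defs.form R n) z :
  wedge (fundamental_form h) a z = Lop (fun i j => 'i%C * h z i j) (a z).
Proof.
apply/funext => S; rewrite LopE /wedge /fundamental_form.
under eq_bigr => A _ do rewrite mulr_sumr mulr_suml.
rewrite exchange_big /=; apply: eq_bigr => i _.
under eq_bigr => A _ do rewrite mulr_sumr mulr_suml.
rewrite exchange_big /=; apply: eq_bigr => j _.
pose P : {set 'I_(n + n)} := [set lshift n i; rshift n j]%SET.
have PS : (P \subset S) = (lshift n i \in S) && (rshift n j \in S).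
  by rewrite /P finset.subUset !finset.sub1set.
have SP : (S :\: P)%SET = ((S :\ lshift n i) :\ rshift n j)%SET.
  by rewrite /P finset.setDDl.
rewrite /= /cre finset.in_setD1 eq_sym lshift_neq_rshift /=.
have [PS1|PS0] := boolP (P \subset S); last first.
  rewrite big1 => [|A]; last first.
    rewrite finset.powersetE => AS; case: eqP => [AP|]; last by rewrite !mulr0 mul0r.
    by rewrite -/P in AP; rewrite -AP AS in PS0.
  move: PS0; rewrite PS negb_and => /orP[/negPf->|/negPf->]; first by rewrite mulr0.
  by case: ifP; rewrite !mulr0.
rewrite (bigD1 P) ?finset.powersetE//= eqxx mulr1 big1 ?addr0; last first.
  by move=> A /andP[_ /negPf AP]; rewrite -/P AP !mulr0 mul0r.
move: PS1; rewrite PS => /andP[iS jS]; rewrite iS jS.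
rewrite shuffle_signE /P big_setU1 /=; last by rewrite !inE lshift_neq_rshift.
(* Every [dz] precedes every [dzbar] in the coframe, so dropping [rshift n j] does not change the
   sign of [lshift n i]. *)
rewrite big_set1 -/P SP (sorting_sign_setD1 (lshift n i) (_ : rshift n j \in (S :\ lshift n i)%SET)).
  have -> : (rshift n j < lshift n i)%N = false.
    by apply/negbTE; rewrite -leqNgt /=; have := ltn_ord i; lia.
  by rewrite expr0 mul1r; ring.
by rewrite !inE eq_sym lshift_neq_rshift.
Qed.

Lemma wedge_powE (h : Cn -> 'M[C]_n) k z :
  wedge_pow (fundamental_form h) k z =
  iter k (Lop (fun i j => 'i%C * h z i j)) vac.
Proof. by elim: k => [|k IHk]//=; rewrite wedge_fundamental IHk. Qed.

Lemma LopD c x y : Lop c (x + y) = Lop c x + Lop c y.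
Proof.
rewrite /Lop -big_split; apply: eq_bigr => i _; rewrite -big_split /=.
by apply: eq_bigr => j _; rewrite !linearD.
Qed.

Lemma Lop_sum c (I : Type) (r : seq I) (G : I -> V) :
  Lop c (\sum_(i <- r) G i) = \sum_(i <- r) Lop c (G i).
Proof.
apply: big_morph; first exact: LopD.
by rewrite /Lop big1// => i _; rewrite big1// => j _; rewrite !linear0.
Qed.

Lemma LopZ c k x : Lop c (k *: x) = k *: Lop c x.
Proof.
rewrite /Lop scaler_sumr; apply: eq_bigr => i _; rewrite scaler_sumr.
apply: eq_bigr => j _; have -> : El i (Er j (k *: x)) = k *: El i (Er j x).
  by rewrite !linearZ.
by rewrite !scalerA mulrC.
Qed.

(** Passing the two covectors of a 2-form changes the sign twice. *)
Lemma cre_Lop a c x : cre a (Lop c x) = Lop c (cre a x : V) :> V.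
Proof.
rewrite /Lop linear_sum; apply: eq_bigr => i _; rewrite linear_sum.
apply: eq_bigr => j _; rewrite linearZ /=; congr (_ *: _).
by rewrite cre_anticomm [cre a (cre _ x)]cre_anticomm linearN opprK.
Qed.

Lemma Lop_comm c c' x : Lop c (Lop c' x) = Lop c' (Lop c x).
Proof.
rewrite [in LHS]/Lop Lop_sum; apply: eq_bigr => i _; rewrite Lop_sum.
apply: eq_bigr => j _; rewrite LopZ; congr (_ *: _).
by rewrite -[RHS]cre_Lop -cre_Lop.
Qed.

Lemma iter_Lop_comm c c' k x : iter k (Lop c) (Lop c' x) = Lop c' (iter k (Lop c) x).
Proof. by elim: k => //= k ->; rewrite Lop_comm. Qed.

Lemma cre_iter_Lop a c k x : cre a (iter k (Lop c) x) = iter k (Lop c) (cre a x : V) :> V.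
Proof. by elim: k => //= k IHk; rewrite cre_Lop IHk. Qed.

Lemma iter_LopD c k : {morph iter k (Lop c) : x y / x + y}.
Proof. by move=> x y; elim: k => //= k ->; rewrite LopD. Qed.

Lemma iter_LopZ c k t x : iter k (Lop c) (t *: x) = t *: iter k (Lop c) x.
Proof. by elim: k => //= k ->; rewrite LopZ. Qed.

Lemma cre_LopE a c x : cre a (Lop c x) =
  \sum_i \sum_j c i j *: cre a (El i (Er j x) : V) :> V.
Proof.
rewrite /Lop linear_sum; apply: eq_bigr => i _; rewrite linear_sum.
by apply: eq_bigr => j _; rewrite linearZ.
Qed.

Lemma delE (a : @Defs.form R n) z : del a z =
  \sum_k El k (fun S => wirt false k (fun w => a w S) z).
Proof.
apply/funext => S; rewrite sum_fctE /del big_mkcond; apply: eq_bigr => k _.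
by rewrite /= /cre wirt.unlock; case: ifP => // _; rewrite shuffle_signE big_set1.
Qed.

Lemma delbarE (a : @Defs.form R n) z : delbar a z =
  \sum_k Er k (fun S => wirt true k (fun w => a w S) z).
Proof.
apply/funext => S; rewrite sum_fctE /delbar big_mkcond; apply: eq_bigr => k _.
by rewrite /= /cre wirt.unlock; case: ifP => // _; rewrite shuffle_signE big_set1.
Qed.

Section Smooth.
Variables (U : set Cn) (h : Cn -> 'M[C]_n).
Hypothesis oU : open U.
Hypothesis sh : forall i j, smooth_on U (fun w => h w i j).

Lemma smooth_ih i j : smooth_on U (fun w => 'i%C * h w i j).
Proof. exact: (smooth_onM oU (smooth_on_cst oU _) (sh i j)). Qed.

Lemma smooth_on_cre a (x : Cn -> V) S : (forall S, smooth_on U (fun w => x w S)) ->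
  smooth_on U (fun w => cre a (x w) S).
Proof.
move=> sx; rewrite /cre; case: (a \in S); last exact: (smooth_on_cst oU 0).
exact: (smooth_onM oU (smooth_on_cst oU _) (sx _)).
Qed.

Lemma smooth_wedge_pow k S :
  smooth_on U (fun w => wedge_pow (fundamental_form h) k w S).
Proof.
elim: k S => [|k IHk] S; first exact: (smooth_on_cst oU _).
pose F w := \sum_i \sum_j ('i%C * h w i j) *
  cre (lshift n i) (cre (rshift n j) (wedge_pow (fundamental_form h) k w)) S.
apply: (smooth_on_eq oU (f := F)) => [z _|].
  by rewrite /= wedge_fundamental LopE.
apply: (smooth_on_sum oU) => i; apply: (smooth_on_sum oU) => j.
apply: (smooth_onM oU (smooth_ih i j)).
by apply: smooth_on_cre => S'; apply: smooth_on_cre => S''.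
Qed.

Lemma wirt_cre s k a (x : Cn -> V) z S : U z -> (forall S, smooth_on U (fun w => x w S)) ->
  wirt s k (fun w => cre a (x w) S) z = cre a (fun S => wirt s k (fun w => x w S) z) S.
Proof.
move=> Uz sx; rewrite /cre; case: (a \in S); last exact: wirt_cst.
exact: (wirtZ oU Uz).
Qed.

(** The power rule in its commutative form, since multiplications by 2-forms commute. At [m = 0] the
    truncated exponent [m.-1] is harmless: the factor [m%:R] vanishes. *)
Lemma wirt_wedge_pow s k m z : U z ->
  (fun S => wirt s k (fun w => wedge_pow (fundamental_form h) m w S) z) =
  m%:R *: Lop (fun i j => 'i%C * wirt s k (fun w => h w i j) z)
    (iter m.-1 (Lop (fun i j => 'i%C * h z i j)) vac) :> V.
Proof.
move=> Uz; elim: m => [|m IHm].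
  by rewrite scale0r; apply/funext => S; exact: wirt_cst.
have sx S := smooth_wedge_pow m S.
have sxx i j S : smooth_on U (fun w => cre (lshift n i) (cre (rshift n j)
    (wedge_pow (fundamental_form h) m w)) S).
  by apply: smooth_on_cre => S'; apply: smooth_on_cre => S''.
pose D : V := fun S => wirt s k (fun w => wedge_pow (fundamental_form h) m w S) z.
transitivity (Lop (fun i j => 'i%C * wirt s k (fun w => h w i j) z)
    (wedge_pow (fundamental_form h) m z : V) +
    Lop (fun i j => 'i%C * h z i j) D).
  apply/funext => S; rewrite fctE !LopE -big_split /=.
  pose F w := \sum_i \sum_j ('i%C * h w i j) *
    cre (lshift n i) (cre (rshift n j) (wedge_pow (fundamental_form h) m w)) S.
  apply: etrans (wirt_eq oU Uz s k (smooth_wedge_pow m.+1 S) (g := F) _) _.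
    by move=> w _; rewrite /= wedge_fundamental LopE.
  have sij i j := smooth_onM oU (smooth_ih i j) (sxx i j S).
  apply: etrans (wirt_sum oU Uz _ s k (fun i => smooth_on_sum oU _ (sij i))) _.
  apply: eq_bigr => i _; rewrite -big_split /=.
  apply: etrans (wirt_sum oU Uz _ s k (sij i)) _.
  apply: eq_bigr => j _.
  apply: etrans (wirtM Uz s k (smooth_ih i j) (sxx i j S)) _.
  congr (_ * _ + _ * _); first exact: (wirtZ oU Uz).
  rewrite wirt_cre//; last by move=> S'; exact: smooth_on_cre.
  congr (cre _ _ S); apply/funext => S'.
  by rewrite wirt_cre.
rewrite /D IHm LopZ wedge_powE -iter_Lop_comm /=.
case: m {IHm sx sxx D} => [|m] /=; first by rewrite scale0r addr0 scale1r.
rewrite iter_Lop_comm Lop_comm -[X in X + _]scale1r -scalerDl.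
by rewrite addrC natr1.
Qed.

Lemma balanced_torsion z (n2 : (2 <= n)%N) : U z -> h z \in unitmx ->
  (forall S, extd (wedge_pow (fundamental_form h) n.-1) z S = 0) ->
  forall m, \sum_i \sum_j hinv h z i j *
    (wirt false m (fun w => h w i j) z - wirt false i (fun w => h w m j) z) = 0.
Proof.
move=> Uz uh bal m.
pose L := Lop (fun i j => 'i%C * h z i j).
pose Lk s k := Lop (fun i j => 'i%C * wirt s k (fun w => h w i j) z).
have ii : 'i%C * 'i%C = -1 :> C by rewrite -expr2 sqr_i.
(* The coefficient matrix of [omega] is ['i%C * h]; its inverse carries [- 'i%C], and the two
   scalars cancel in the trace, leaving [tau_m] itself. *)
have tt := @torsion_trace _ n n2 (fun i j => 'i%C * h z i j)
  (fun j i => - 'i%C * invmx (h z) j i) _ _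
  (fun k i j => 'i%C * wirt false k (fun w => h w i j) z)
  (fun k i j => 'i%C * wirt true k (fun w => h w i j) z) _ m.
have Dk s k : (fun S => wirt s k (fun w => wedge_pow (fundamental_form h) n.-1 w S) z) =
    (n.-1%:R : C) *: iter n.-2 L (Lk s k vac) :> V.
  by rewrite wirt_wedge_pow// /L iter_Lop_comm.
rewrite -[RHS]tt.
- apply: eq_bigr => i _; apply: eq_bigr => j _; rewrite /hinv.
  by rewrite mulrC; ring: ii.
- move=> i k; rewrite -[RHS]/((i == k)%:R : C).
  have /matrixP/(_ k i) := mulmxV uh; rewrite !mxE eq_sym => <-.
  by apply: eq_bigr => j _; ring: ii.
- move=> k j.
  have /matrixP/(_ k j) := mulVmx uh; rewrite !mxE eq_sym => <-.
  by apply: eq_bigr => i _; ring: ii.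
(* The factor [n - 1] comes from differentiating the power; it is nonzero and cancels. *)
have n0 : n.-1%:R != 0 :> C by rewrite pnatr_eq0; lia.
apply: (scalerI n0); rewrite scaler0 -iter_LopZ.
have balE : \sum_k El k ((n.-1%:R : C) *: iter n.-2 L (Lk false k vac)) +
    \sum_k Er k ((n.-1%:R : C) *: iter n.-2 L (Lk true k vac)) = 0.
  apply/funext => S; apply: etrans _ (bal S); rewrite /extd delE delbarE.
  apply/esym/(congr2 (fun A B : V => A S + B S)); apply: eq_bigr => k _.
    by rewrite Dk.
  by rewrite Dk.
have L0 : iter n.-2 L 0 = 0.
  by have := iter_LopZ (fun i j => 'i%C * h z i j) n.-2 0 0; rewrite !scale0r.
apply: etrans _ balE.
rewrite -big_split scaler_sumr (big_morph _ (iter_LopD _ _) L0) /=.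
apply: eq_bigr => k _; rewrite iter_LopZ.
have eZ a x : cre a ((n.-1%:R : C) *: iter n.-2 L x) =
    (n.-1%:R : C) *: iter n.-2 L (cre a x : V) :> V.
  by rewrite linearZ /= cre_iter_Lop.
rewrite !eZ -scalerDr -iter_LopD; congr (_ *: iter _ _ _).
rewrite !cre_LopE -big_split /=; apply: eq_bigr => i _.
by rewrite -big_split.
Qed.
End Smooth.
End Wedge.

(** * Chern curvature of a balanced metric *)

Section Geometry.
Local Open Scope ring_scope.
Local Open Scope complex_scope.
Context {R : realType} {n : nat}.
Local Notation C := R[i].
Local Notation Cn := 'rV[C]_n.
Variables (U : set Cn) (h : Cn -> 'M[C]_n).
Hypothesis oU : open U.
Hypothesis sh : forall i j, smooth_on U (fun w => h w i j).
Hypothesis uh : forall z, U z -> h z \in unitmx.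
Hypothesis hh : forall z i j, U z -> h z i j = conjc (h z j i).

Let H k l : Cn -> C := fun w => h w k l.
Let g k l : Cn -> C := fun w => hinv h w k l.
Let sH k l : smooth_on U (H k l) := sh k l.

Let sg k l : smooth_on U (g k l).
Proof. exact: (smooth_on_invmx oU l k uh sh). Qed.

Lemma sum_hinv_h z p k : U z -> \sum_q hinv h z p q * h z k q = (p == k)%:R.
Proof.
move=> Uz; have /matrixP/(_ k p) := mulmxV (uh Uz); rewrite !mxE eq_sym => <-.
by apply: eq_bigr => q _; rewrite mulrC.
Qed.

Lemma sum_h_hinv z q l : U z -> \sum_p h z p q * hinv h z p l = (q == l)%:R.
Proof.
move=> Uz; have /matrixP/(_ l q) := mulVmx (uh Uz); rewrite !mxE eq_sym => <-.
by apply: eq_bigr => p _; rewrite mulrC.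
Qed.

Lemma sum_deltaM (G : 'I_n -> C) k : \sum_i (i == k)%:R * G i = G k.
Proof. exact: (@sum_delta C C^o n G k). Qed.

Lemma chernE z i j k l : chern h z i j k l =
  - wirt false i (wirt true j (H k l)) z + \sum_p \sum_q
    hinv h z p q * wirt true j (H p l) z * wirt false i (H k q) z.
Proof. by rewrite wirt.unlock. Qed.

(* Differentiate [h * h^-1 = 1]. *)
Lemma wirt_hinv s m k l z : U z -> wirt s m (g k l) z =
  - \sum_p \sum_q hinv h z k q * hinv h z p l * wirt s m (H p q) z.
Proof.
move=> Uz.
have D a : \sum_q (wirt s m (g k q) z * h z a q + hinv h z k q * wirt s m (H a q) z) = 0.
  pose F w := \sum_q g k q w * H a q w.
  have sF q : smooth_on U (fun w => g k q w * H a q w) by exact: smooth_onM.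
  apply: etrans _ (wirt_cst z s m ((k == a)%:R)).
  apply: etrans _ (wirt_eq oU Uz s m (smooth_on_sum oU _ sF) _); last first.
    by move=> w Uw; exact: sum_hinv_h.
  apply/esym; apply: etrans (wirt_sum oU Uz _ s m sF) _.
  by apply: eq_bigr => q _; exact: (wirtM Uz).
transitivity (\sum_a hinv h z a l * \sum_q wirt s m (g k q) z * h z a q).
  under eq_bigr => a _ do rewrite mulr_sumr.
  rewrite exchange_big /=.
  rewrite -[LHS](sum_deltaM (fun q => wirt s m (g k q) z)).
  apply: eq_bigr => q _; rewrite -(sum_h_hinv q l Uz) mulr_suml.
  by apply: eq_bigr => a _; ring.
rewrite -sumrN; apply: eq_bigr => a _; have := D a; rewrite big_split /=.
move=> /eqP; rewrite addr_eq0 => /eqP ->; rewrite mulrN mulr_sumr; congr (- _).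
by apply: eq_bigr => q _; ring.
Qed.

(** The correction from differentiating [hinv] has the form of the quadratic term of the Chern
    curvature; with a derivative of [h] for [X], the right-hand side becomes a curvature trace. *)
Lemma wirt_trace (X : 'I_n -> 'I_n -> Cn -> C) s m z :
  (forall k l, smooth_on U (X k l)) -> U z ->
  wirt s m (fun w => \sum_k \sum_l g k l w * X k l w) z =
  \sum_k \sum_l hinv h z k l * (wirt s m (X k l) z -
    \sum_p \sum_q hinv h z p q * wirt s m (H p l) z * X k q z).
Proof.
move=> sX Uz.
have sM k l : smooth_on U (fun w => g k l w * X k l w) by exact: smooth_onM.
apply: etrans (wirt_sum oU Uz _ s m (fun k => smooth_on_sum oU _ (sM k))) _.
transitivity (\sum_k \sum_l (wirt s m (g k l) z * X k l z +
   hinv h z k l * wirt s m (X k l) z)).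
  apply: eq_bigr => k _; apply: etrans (wirt_sum oU Uz _ s m (sM k)) _.
  by apply: eq_bigr => l _; exact: (wirtM Uz).
apply: eq_bigr => k _; rewrite big_split /= addrC.
under [RHS]eq_bigr => l _ do rewrite mulrBr.
rewrite sumrB; congr (_ + _).
under eq_bigr => l _ do rewrite wirt_hinv// mulNr.
rewrite sumrN; congr (- _).
under eq_bigr => l _ do rewrite mulr_suml.
under [RHS]eq_bigr => l _ do rewrite mulr_sumr.
rewrite exchange_big [RHS]exchange_big /=; apply: eq_bigr => p _.
under eq_bigr => l _ do rewrite mulr_suml.
under [RHS]eq_bigr => l _ do rewrite mulr_sumr.
rewrite exchange_big /=; apply: eq_bigr => l _; apply: eq_bigr => q _.
ring.
Qed.

(** [tau_i] is [A i - B i]. The halves are kept apart because [Theta^(1)] and [Theta^(4)] are minus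
    their respective dbar-derivatives. *)
Let A i : Cn -> C := fun w => \sum_k \sum_l g k l w * wirt false i (H k l) w.
Let B i : Cn -> C := fun w => \sum_k \sum_l g k l w * wirt false k (H i l) w.

Let sA i : smooth_on U (A i).
Proof.
apply: (smooth_on_sum oU) => k; apply: (smooth_on_sum oU) => l.
exact: (smooth_onM oU (sg k l) (smooth_on_wirt oU _ _ (sH k l))).
Qed.

(** The index maps choose which unbarred slot is contracted: a constant [a] with [b = id] gives
    [Theta^(1)], and the reverse gives [Theta^(4)]. *)
Lemma trace_chern (a b : 'I_n -> 'I_n) j z : U z ->
  \sum_k \sum_l hinv h z k l * chern h z (a k) j (b k) l =
  - wirt true j (fun w => \sum_k \sum_l g k l w * wirt false (a k) (H (b k) l) w) z.
Proof.
move=> Uz; rewrite wirt_trace//; last by move=> k l; exact: smooth_on_wirt.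
rewrite -sumrN; apply: eq_bigr => k _; rewrite -sumrN; apply: eq_bigr => l _.
rewrite chernE (wirt_comm oU true false j (a k) Uz (sH (b k) l)) -mulrN opprB.
by rewrite addrC.
Qed.

Lemma chern_ricci1E z i j : U z -> chern_ricci1 h z i j = - wirt true j (A i) z.
Proof. by move=> Uz; rewrite mxE (trace_chern (fun=> i) id). Qed.

Lemma chern_ricci4E z i j : U z -> chern_ricci4 h z i j = - wirt true j (B i) z.
Proof. by move=> Uz; rewrite mxE (trace_chern id (fun=> i)). Qed.

Lemma conj_hinv z p q : U z -> conjc (hinv h z p q) = hinv h z q p.
Proof.
move=> Uz; rewrite /hinv.
have hT : map_mx (@conjc R) (h z) = (h z)^T.
  by apply/matrixP => i j; rewrite !mxE [RHS]hh.
have := map_invmx (@conjc R : {rmorphism C -> C}) (h z) => /matrixP/(_ q p).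
by rewrite !mxE hT -trmx_inv mxE.
Qed.

Lemma conj_wirt_h s m k l z : U z ->
  conjc (wirt s m (H k l) z) = wirt (~~ s) m (H l k) z.
Proof.
move=> Uz; rewrite -[s in LHS]negbK -(wirt_conj Uz _ _ (sH k l)).
apply: (wirt_eq oU Uz); first exact: (smooth_on_conj oU).
by move=> w Uw; rewrite /H [RHS]hh.
Qed.

Lemma conjc_sum (I : Type) (r : seq I) (G : I -> C) :
  conjc (\sum_(i <- r) G i) = \sum_(i <- r) conjc (G i).
Proof. exact: rmorph_sum. Qed.

(** Conjugation swaps the indices of [h] and the types of the derivatives; commuting second
    derivatives restores their order. *)
Lemma conj_chern z i j k l : U z -> conjc (chern h z i j k l) = chern h z j i l k.
Proof.
move=> Uz; rewrite !chernE conjcD; congr (_ + _).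
  have -> (x : C) : conjc (- x) = - conjc x by exact: rmorphN.
  congr (- _); rewrite -(wirt_conj Uz true i (smooth_on_wirt oU true j (sH k l))).
  rewrite (wirt_comm oU false true j i Uz (sH l k)).
  apply: (wirt_eq oU Uz).
    exact: (smooth_on_conj oU (smooth_on_wirt oU _ _ (sH k l))).
  by move=> w Uw; exact: conj_wirt_h.
rewrite conjc_sum [RHS]exchange_big /=; apply: eq_bigr => p _.
rewrite conjc_sum; apply: eq_bigr => q _.
by rewrite !conjcM conj_hinv// !conj_wirt_h//=; ring.
Qed.

Lemma chern_ricci3_conj z i j : U z ->
  chern_ricci3 h z i j = conjc (chern_ricci4 h z j i).
Proof.
move=> Uz; apply: etrans (mxE _ _ _ _) _.
apply: etrans _ (congr1 (@conjc R) (esym (mxE _ _ _ _))).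
rewrite conjc_sum exchange_big /=; apply: eq_bigr => k _.
rewrite conjc_sum; apply: eq_bigr => l _.
by rewrite conjcM conj_hinv// conj_chern.
Qed.

Lemma chern_ricci1_conj z i j : U z ->
  chern_ricci1 h z i j = conjc (chern_ricci1 h z j i).
Proof.
move=> Uz; apply: etrans (mxE _ _ _ _) _.
apply: etrans _ (congr1 (@conjc R) (esym (mxE _ _ _ _))).
rewrite conjc_sum exchange_big /=; apply: eq_bigr => k _.
rewrite conjc_sum; apply: eq_bigr => l _.
by rewrite conjcM conj_hinv// conj_chern.
Qed.

Lemma chern_scalar2E z :
  chern_scalar2 h z = \sum_i \sum_l hinv h z i l * chern_ricci3 h z i l.
Proof.
apply: eq_bigr => i _; rewrite exchange_big /=.
under [RHS]eq_bigr => l _ do rewrite [chern_ricci3 h z i l]mxE mulr_sumr.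
rewrite [RHS]exchange_big /=; apply: eq_bigr => k _.
rewrite exchange_big /=; apply: eq_bigr => l _; rewrite mulr_sumr.
by apply: eq_bigr => j _; rewrite mulrA.
Qed.

(** Cyclicity of the trace: exchanging the pairs [(a, b)] and [(p, q)] interchanges [X] and [Y] in
    the quadratic term. *)
Lemma trace_symmetry (G D D' X Y : 'I_n -> 'I_n -> C) :
  (forall a b, D a b = D' a b) ->
  \sum_a \sum_b G a b * (D a b - \sum_p \sum_q G p q * X p b * Y a q) =
  \sum_a \sum_b G a b * (D' a b - \sum_p \sum_q G p q * Y p b * X a q).
Proof.
move=> DD'.
have E (D0 X0 Y0 : 'I_n -> 'I_n -> C) :
    \sum_a \sum_b G a b * (D0 a b - \sum_p \sum_q G p q * X0 p b * Y0 a q) =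
    \sum_a \sum_b G a b * D0 a b -
    \sum_a \sum_b \sum_p \sum_q G a b * (G p q * X0 p b * Y0 a q).
  rewrite -sumrB; apply: eq_bigr => a _; rewrite -sumrB; apply: eq_bigr => b _.
  rewrite mulrBr mulr_sumr; congr (_ - _).
  by apply: eq_bigr => p _; rewrite mulr_sumr.
rewrite !E; congr (_ - _).
  by apply: eq_bigr => a _; apply: eq_bigr => b _; rewrite DD'.
under eq_bigr do rewrite exchange_big /=.
rewrite exchange_big /=; apply: eq_bigr => p _.
under eq_bigr do rewrite exchange_big /=.
rewrite exchange_big /=; apply: eq_bigr => q _; apply: eq_bigr => a _.
by apply: eq_bigr => b _; ring.
Qed.

(* [A i] is the logarithmic derivative d/dz^i (log det h). *)
Lemma wirt_logdet_comm k i z : U z ->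
  wirt false k (A i) z = wirt false i (A k) z.
Proof.
move=> Uz.
have dA a b := wirt_trace false a (fun k l => smooth_on_wirt oU false b (sH k l)) Uz.
apply: etrans (dA k i) _; apply: etrans _ (esym (dA i k)).
apply: trace_symmetry => a b; exact: (wirt_comm oU).
Qed.

Section Balanced.
Hypothesis n2 : (2 <= n)%N.
Hypothesis bal : forall z, U z -> forall S,
  extd (wedge_pow (fundamental_form h) n.-1) z S = 0.

Lemma torsion_free_trace m z : U z -> A m z = B m z.
Proof.
move=> Uz; have := balanced_torsion oU sh n2 Uz (uh Uz) (bal Uz) m.
move=> /eqP; under eq_bigr do under eq_bigr do rewrite mulrBr.
under eq_bigr do rewrite sumrB.
by rewrite sumrB subr_eq0 => /eqP.
Qed.

Lemma chern_ricci14 z : U z -> chern_ricci4 h z = chern_ricci1 h z.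
Proof.
move=> Uz; apply/matrixP => i j.
apply: etrans (chern_ricci4E i j Uz) _; apply: etrans _ (esym (chern_ricci1E i j Uz)).
congr (- _); apply/esym/(wirt_eq oU Uz _ _ (sA i)) => w Uw.
exact: torsion_free_trace.
Qed.

Lemma chern_ricci13 z : U z -> chern_ricci3 h z = chern_ricci1 h z.
Proof.
move=> Uz; apply/matrixP => i j.
apply: etrans (chern_ricci3_conj i j Uz) _.
apply: etrans _ (esym (chern_ricci1_conj i j Uz)).
by rewrite (chern_ricci14 Uz).
Qed.

Lemma chern_scalar12 z : U z -> chern_scalar2 h z = chern_scalar1 h z.
Proof. by move=> Uz; apply: etrans (chern_scalar2E z) _; rewrite (chern_ricci13 Uz). Qed.

(** The (2,1)-part of the closedness of [Theta^(1)]: its entries are dbar-derivatives of the [A i],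
    whose d-derivatives are symmetric by [wirt_logdet_comm]. *)
Lemma wirt_ricci1_comm i j k z : U z ->
  wirt false k (fun w => chern_ricci1 h w i j) z =
  wirt false i (fun w => chern_ricci1 h w k j) z.
Proof.
move=> Uz.
have E a b : wirt false a (fun w => chern_ricci1 h w b j) z =
    -1 * wirt true j (wirt false a (A b)) z.
  have sW := smooth_on_wirt oU true j (sA b).
  rewrite -(wirt_comm oU false true a j Uz (sA b)) -(wirtZ oU Uz _ _ _ sW).
  apply/esym/(wirt_eq oU Uz); first exact: (smooth_onM oU (smooth_on_cst oU _) sW).
  by move=> w Uw; rewrite chern_ricci1E// mulN1r.
rewrite !E; congr (_ * _).
apply: (wirt_eq oU Uz); first exact: smooth_on_wirt.
by move=> w Uw; exact: wirt_logdet_comm.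
Qed.

Variable F : Cn -> R.
Hypothesis sF : smooth_on U (fun w => (F w)%:C).
Hypothesis hF : forall z, U z ->
  chern_ricci3 h z + chern_ricci4 h z = (F z)%:C *: h z.

Lemma ricci1_eq z : U z -> chern_ricci1 h z = (F z / 2)%:C *: h z.
Proof.
move=> Uz; have := hF Uz; rewrite (chern_ricci13 Uz) (chern_ricci14 Uz) => E.
have h2 : 2%:R != 0 :> C by rewrite pnatr_eq0.
apply: (scalerI h2); rewrite scalerA scaler_nat mulr2n E; congr (_ *: _).
by rewrite rmorphM fmorphV rmorph_nat mulrC divfK.
Qed.

(** The (2,1)-part of [d (f omega) = 0], in coordinates. *)
Lemma wirt_Fh i j k z : U z ->
  wirt false k (fun w => (F w)%:C) z * h z i j + (F z)%:C * wirt false k (H i j) z =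
  wirt false i (fun w => (F w)%:C) z * h z k j + (F z)%:C * wirt false i (H k j) z.
Proof.
move=> Uz; rewrite -(wirtM Uz false k sF (sH i j)) -(wirtM Uz false i sF (sH k j)).
have E a b : wirt false a (fun w => (F w)%:C * H b j w) z =
    2%:R * wirt false a (fun w => chern_ricci1 h w b j) z.
  have sr : smooth_on U (fun w => chern_ricci1 h w b j).
    apply: (smooth_on_eq oU (f := fun w => -1 * wirt true j (A b) w)).
      by move=> w Uw; rewrite chern_ricci1E// mulN1r.
    exact: (smooth_onM oU (smooth_on_cst oU _) (smooth_on_wirt oU _ _ (sA b))).
  rewrite -(wirtZ oU Uz _ _ _ sr).
  apply: (wirt_eq oU Uz); first exact: (smooth_onM oU sF (sH b j)).
  move=> w Uw; rewrite ricci1_eq// mxE mulrA; congr (_ * _).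
  by rewrite rmorphM fmorphV rmorph_nat mulrC divfK// pnatr_eq0.
by rewrite !E wirt_ricci1_comm.
Qed.

Lemma sum_hinv_h_nat z : U z -> \sum_i \sum_j hinv h z i j * h z i j = n%:R.
Proof.
move=> Uz; under eq_bigr => i _ do rewrite sum_hinv_h// eqxx.
by rewrite sumr_const card_ord.
Qed.

Lemma wirt_F0 k z : U z -> wirt false k (fun w => (F w)%:C) z = 0.
Proof.
move=> Uz; pose dF i := wirt false i (fun w => (F w)%:C) z.
(* Contraction with [h^{i jbar}] turns [h_{i jbar}] into [n] but [h_{k jbar}] into a Kronecker
   delta; the terms in [A] and [B] then cancel by [torsion_free_trace]. *)
have E : n%:R * dF k + (F z)%:C * A k z = dF k + (F z)%:C * B k z.
  have -> : n%:R * dF k + (F z)%:C * A k z = \sum_i \sum_j hinv h z i j *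
      (dF k * h z i j + (F z)%:C * wirt false k (H i j) z).
    rewrite -(sum_hinv_h_nat Uz) mulr_suml mulr_sumr -big_split /=.
    apply: eq_bigr => i _; rewrite mulr_suml mulr_sumr -big_split /=.
    by apply: eq_bigr => j _; rewrite /g; ring.
  have W i j : dF k * h z i j + (F z)%:C * wirt false k (H i j) z =
      dF i * h z k j + (F z)%:C * wirt false i (H k j) z := wirt_Fh i j k Uz.
  under eq_bigr => i _ do under eq_bigr => j _ do rewrite W.
  have -> : dF k = \sum_i \sum_j hinv h z i j * (dF i * h z k j).
    rewrite -[LHS](sum_deltaM dF); apply: eq_bigr => i _.
    by rewrite -(sum_hinv_h i k Uz) mulr_suml; apply: eq_bigr => j _; ring.
  rewrite mulr_sumr -big_split /=; apply: eq_bigr => i _.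
  rewrite mulr_sumr -big_split /=; apply: eq_bigr => j _.
  by rewrite /g; ring.
move: E; rewrite torsion_free_trace// => /addIr /eqP.
rewrite -[X in _ == X]mul1r -subr_eq0 -mulrBl mulf_eq0 => /orP[|/eqP//].
by rewrite subr_eq0 pnatr_eq1; lia.
Qed.

Lemma wirt_h_comm i j k z : U z -> F z != 0 ->
  wirt false k (H i j) z = wirt false i (H k j) z.
Proof.
move=> Uz F0; have := wirt_Fh i j k Uz; rewrite !wirt_F0// !mul0r !add0r.
by apply: mulfI; rewrite eq_complex /= eqxx andbT.
Qed.

Lemma chern_scalar1E z : U z -> chern_scalar1 h z = n%:R * (F z / 2)%:C.
Proof.
move=> Uz; rewrite /chern_scalar1 ricci1_eq// -(sum_hinv_h_nat Uz) mulr_suml.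
apply: eq_bigr => i _; rewrite mulr_suml; apply: eq_bigr => j _.
by rewrite mxE; ring.
Qed.

End Balanced.
End Geometry.

(** * The theorem *)

Section Closed.
Local Open Scope ring_scope.
Local Open Scope complex_scope.
Context {R : realType} {n : nat}.
Local Notation C := R[i].
Local Notation Cn := 'rV[C]_n.
Local Notation V := ({set 'I_(n + n)} -> C^o).
Local Notation El i := (cre (lshift n i) : {linear V -> V}).
Local Notation Er j := (cre (rshift n j) : {linear V -> V}).

Lemma cre_cre_vac (i j : 'I_n) S : (El i (Er j vac) : V) S =
  (S == [set lshift n i; rshift n j]%SET)%:R.
Proof.
rewrite /= /cre -/(cre _ _ _) cre_vac; case: ifPn => iS.
  have -> : (S == [set lshift n i; rshift n j]%SET) = ((S :\ lshift n i)%SET == [set rshift n j]%SET).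
    apply/eqP/eqP => [->|E]; last by rewrite -(finset.setD1K iS) E.
    by rewrite finset.setU1K// !inE lshift_neq_rshift.
  case: eqP => [->|_]; last by rewrite mulr0.
  rewrite mulr1 /sorting_sign big_set1 /=.
  have -> : (n + j < i)%N = false by have := ltn_ord i; lia.
  by [].
by case: eqP => // E; move: iS; rewrite E !inE eqxx.
Qed.

(** As a first power, [omega] falls under [wirt_wedge_pow], which then computes [d omega]. *)
Lemma fundamental_formE (h : Cn -> 'M[C]_n) :
  fundamental_form h = wedge_pow (fundamental_form h) 1.
Proof.
apply/funext => z; rewrite wedge_powE /=; apply/funext => S; rewrite LopE.
by apply: eq_bigr => i _; apply: eq_bigr => j _; rewrite cre_cre_vac.
Qed.

Lemma antisymmetric_sum (G : 'I_n -> 'I_n -> V) :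
  (forall i j, G i j = - G j i) -> \sum_i \sum_j G i j = 0.
Proof.
move=> GN; apply/(@scalerI _ V 2%:R); first by rewrite pnatr_eq0.
rewrite scaler0 scaler_nat mulr2n {2}exchange_big -big_split big1//= => i _.
by rewrite -big_split big1//= => j _; rewrite [G j i]GN subrr.
Qed.

(** The derivatives of [h] are symmetric in two indices in which the wedge products are
    antisymmetric; the two bidegrees vanish separately. *)
Lemma extd_fundamental_form (U : set Cn) (h : Cn -> 'M[C]_n) z : open U ->
  (forall i j, smooth_on U (fun w => h w i j)) -> U z ->
  (forall i j k, wirt false k (fun w => h w i j) z = wirt false i (fun w => h w k j) z) ->
  (forall i j k, wirt true k (fun w => h w i j) z = wirt true j (fun w => h w i k) z) ->
  forall S, extd (fundamental_form h) z S = 0.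
Proof.
move=> oU sh Uz h10 h01 S; rewrite fundamental_formE /extd delE delbarE.
have D s k : (fun S => wirt s k (fun w => wedge_pow (fundamental_form h) 1 w S) z) =
    Lop (fun i j => 'i%C * wirt s k (fun w => h w i j) z) vac.
  by rewrite (wirt_wedge_pow oU sh)// scale1r.
have e1 : \sum_k El k (Lop (fun i j => 'i%C * wirt false k (fun w => h w i j) z) vac) = 0.
  under eq_bigr => k _ do rewrite /= cre_LopE.
  apply: antisymmetric_sum => k i; rewrite -sumrN; apply: eq_bigr => j _.
  by rewrite h10 /= cre_anticomm scalerN.
have e2 : \sum_k Er k (Lop (fun i j => 'i%C * wirt true k (fun w => h w i j) z) vac) = 0.
  under eq_bigr => k _ do rewrite /= cre_LopE.
  rewrite exchange_big big1//= => i _; apply: antisymmetric_sum => k j.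
  have -> : Er k (El i (Er j vac)) = - Er j (El i (Er k vac)).
    rewrite /= (cre_anticomm (rshift n k) (lshift n i)); congr (- _).
    rewrite (cre_anticomm (rshift n j) (lshift n i)).
    by rewrite (cre_anticomm (rshift n k) (rshift n j)) linearN.
  by rewrite h01 scalerN.
under eq_bigr => k _ do rewrite D.
rewrite e1 add0r.
rewrite (eq_bigr (fun k => Er k (Lop (fun i j => 'i%C * wirt true k (fun w => h w i j) z) vac))).
  by rewrite e2.
by move=> k _; rewrite D.
Qed.

Lemma posdef_unitmx (A : 'M[C]_n) : hermitian_posdef A -> A \in unitmx.
Proof.
move=> [_ pA]; rewrite unitmxE unitfE; apply/det0P => -[v v0 vA].
by have := pA v v0; rewrite vA mul0mx mxE ltxx.
Qed.

Lemma posdef_conj (A : 'M[C]_n) i j : hermitian_posdef A -> A i j = conjc (A j i).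
Proof. by move=> [/matrixP/(_ i j) <- _]; rewrite !mxE. Qed.
End Closed.

(** * From local to global constancy *)

Section LocallyConstant.
Local Open Scope classical_set_scope.
Local Open Scope ring_scope.
Context {R : realType} {n : nat} {T : topologicalType}.

(** Local constancy makes the preimage of every set of values open, so the level set through [p] is
    both open and closed. *)
Lemma connected_locally_constant (f : T -> R) : connected [set: T] ->
  (forall p, nbhs p [set q | f q = f p]) -> forall p q, f q = f p.
Proof.
move=> cT fl p q.
have opf (P : set R) : open [set q | P (f q)].
  rewrite openE => x Px; apply: filterS (fl x) => y /= ->; exact: Px.
suff : [set q | f q = f p] = setT by move/seteqP => [_ /(_ q I)].
apply: cT; first by exists p.
- by exists [set q | f q = f p]; [exact: (opf [set x | x = f p])|rewrite setTI].
- exists [set q | f q = f p]; last by rewrite setTI.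
  rewrite -[X in closed X]setCK; apply: open_closedC.
  exact: (opf [set x | x <> f p]).
Qed.

Lemma chart_nbhs (c : chart R n T) p (N : set 'rV[R[i]]_n) :
  chart_dom c p -> nbhs (chart_map c p) N ->
  nbhs p [set q | chart_dom c q /\ N (chart_map c q)].
Proof.
move=> cp nN.
have op := open_nbhs_nbhs (conj (chart_dom_open c) cp).
have := chart_map_continuous (c := c).
rewrite continuous_open_subspace; last exact: chart_dom_open.
move=> /(_ p (mem_set cp)) /(_ _ nN) nM.
exact: filterI op nM.
Qed.
End LocallyConstant.

Theorem corollary1p7 (R : realType) (n : nat) (n_ge3 : (3 <= n)%N)
    (T : topologicalType) (M : complex_manifold R n T)
    (M_compact : compact [set: T]%classic)
    (omega : hermitian_metric M)
    (omega_pluriclosed : pluriclosed omega)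
    (omega_balanced : balanced omega)
    (f : T -> R) (f_smooth : smooth_real_function M f)
    (omega_eq : chern_ricci34_eq omega f) :
  (chern_scalar2_zero omega \/
     (kaehler_einstein omega /\ scalar_curvature_neq0 omega)) /\
  ~ (chern_scalar2_zero omega /\
     (kaehler_einstein omega /\ scalar_curvature_neq0 omega)).
Proof.
have n2 : (2 <= n)%N by exact: ltnW.
pose h c := metric_coef omega c.
have oU (c : chart R n T) : open (chart_img c) by exact: chart_img_open.
have cs c (Mc : atlas M c) := metric_smooth omega Mc.
have cu c (Mc : atlas M c) z (Uz : chart_img c z) :=
  posdef_unitmx (metric_posdef omega Mc Uz).
have ch c (Mc : atlas M c) z i j (Uz : chart_img c z) :=
  posdef_conj i j (metric_posdef omega Mc Uz).
have cb c (Mc : atlas M c) := omega_balanced c Mc.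
have cf c (Mc : atlas M c) := f_smooth c Mc.
have ce c (Mc : atlas M c) := omega_eq c Mc.
have S12 c (Mc : atlas M c) z (Uz : chart_img c z) :
    chern_scalar2 (h c) z = chern_scalar1 (h c) z.
  exact: (chern_scalar12 (oU c) (cs c Mc) (cu c Mc) (ch c Mc) n2 (cb c Mc) Uz).
have S1 c (Mc : atlas M c) z (Uz : chart_img c z) :
    chern_scalar1 (h c) z = (n%:R * (f (chart_inv c z) / 2)%:C%C)%R.
  exact: (chern_scalar1E (oU c) (cs c Mc) (cu c Mc) (ch c Mc) n2 (cb c Mc) (ce c Mc) Uz).
have [p0 _] := manifold_nonempty M.
(* Chart domains need not be connected, so constancy is established near each point and globalised
   on [T]. *)
have fcst p : f p = f p0.
  apply: (connected_locally_constant (manifold_connected M)) => {}p.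
  have [c Mc cp] := atlas_cover M p.
  have Uz : chart_img c (chart_map c p) by exists p.
  have := wirt0_locally_constant (oU c) Uz (cf c Mc) (fun w j Uw =>
    wirt_F0 (oU c) (cs c Mc) (cu c Mc) (ch c Mc) n2 (cb c Mc) (cf c Mc) (ce c Mc) j Uw).
  move=> /(chart_nbhs cp); apply: filterS => q [cq].
  by rewrite !chart_mapK// inE.
split.
- have [f0|f0] := eqVneq (f p0) 0%R.
    by left=> c Mc z Uz; rewrite S12// S1// fcst f0 mul0r mulr0.
  right; split; last first.
    move=> c Mc z Uz; rewrite S1// fcst mulf_neq0// ?pnatr_eq0; first by lia.
    by rewrite eq_complex /= eqxx andbT mulf_neq0// invr_eq0 pnatr_eq0.
  split; last first.
    exists (f p0 / 2)%R => c Mc z Uz.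
    rewrite -(fcst (chart_inv c z)).
    exact: (ricci1_eq (oU c) (cs c Mc) (cu c Mc) (ch c Mc) n2 (cb c Mc) (ce c Mc) Uz).
  move=> c Mc z Uz; apply: (extd_fundamental_form (oU c) (cs c Mc) Uz).
  + move=> i j k.
    apply: (wirt_h_comm (oU c) (cs c Mc) (cu c Mc) (ch c Mc) n2 (cb c Mc) (cf c Mc) (ce c Mc)) => //.
    by rewrite fcst.
  (* Since [h] is Hermitian, the dbar-symmetry is the conjugate of the d-symmetry. *)
  + move=> i j k; have CW := conj_wirt_h (oU c) (cs c Mc) (ch c Mc).
    rewrite -(CW false k j i z Uz) -(CW false j k i z Uz); congr (conjc _).
    apply: (wirt_h_comm (oU c) (cs c Mc) (cu c Mc) (ch c Mc) n2 (cb c Mc) (cf c Mc) (ce c Mc)) => //.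
    by rewrite fcst.
(* Nonemptiness supplies the point [p0], at which the common value of the two scalar curvatures
   would be both zero and nonzero. *)
- move=> [S20 [_ S1n0]].
  have [c Mc cp] := atlas_cover M p0.
  have Uz : chart_img c (chart_map c p0) by exists p0.
  by have := S1n0 c Mc _ Uz; rewrite -S12// S20// eqxx.
Qed.
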